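(* For $n\ge2$ let $U$ be an $n\times n$ random unitary matrix distributed according to Haar probability measure on the unitary group $U(n)$ (circular unitary ensemble), let $\theta\in\mathbb{R}$, let $Z=Z(U,\theta):=\det(I-Ue^{-i\theta})$, and let $\sigma_{n,2}^2:=\mathbb{V}(\Re\log Z)$, where $\Re\log Z=\log|Z|$. Put $Z_n:=\frac{\Re\log Z}{\sigma_{n,2}}$ and let $N$ be a standard normally distributed random variable. Then for every even $k\ge4$ there is a constant $C_1(k)$, not depending on $n$, such that for all $n\ge2$ $$\bigl|\mathbb{E}(Z_n^k)-\mathbb{E}(N^k)\bigr|\le C_1(k)\,\frac1{\log n}.$$
   Context: $\mathbb{V}$ denotes variance. *)

(* Defs.v *)
From HB Require Import structures.
From mathcomp Require Import all_boot all_order all_algebra.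
From mathcomp Require Import complex.
From mathcomp Require Import all_classical all_reals all_analysis.
Set Implicit Arguments.
Unset Strict Implicit.
Unset Printing Implicit Defensive.
Import Order.TTheory GRing.Theory Num.Theory.
Import numFieldNormedType.Exports.
Local Open Scope classical_set_scope.
Local Open Scope ring_scope.

(* [R[i]] packed as a [numClosedFieldType], through which it gets the topology
   of its modulus; on bare [R[i]] no topology is inferred. *)
Definition cplx (R : realType) : numClosedFieldType := (R[i])%C.

Definition mxborel (R : realType) (n : nat) : measurableType _ :=
  g_sigma_algebraType (@open 'M[cplx R]_n).

Definition unitary_group (R : realType) (n : nat) : set 'M[cplx R]_n :=
  [set V | V \is unitarymx].
Arguments unitary_group : clear implicits.

(* The Haar probability measure of U(n), seen as a Borel measure on the space
   of all n x n matrices that is carried by U(n). *)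
Definition haar_unitary (R : realType) (n : nat)
    (mu : probability (mxborel R n) R) : Prop :=
  mu (unitary_group R n) = 1%E /\
  forall (V : 'M[cplx R]_n) (A : set (mxborel R n)),
    V \is unitarymx -> measurable A -> A `<=` unitary_group R n ->
    mu [set V *m M | M in A] = mu A.

Definition expi (R : realType) (t : R) : cplx R := (cos t +i* sin t)%C.

Definition charpolyZ (R : realType) (n : nat) (U : 'M[cplx R]_n) (theta : R) :
    cplx R :=
  \det (1%:M - expi (- theta) *: U).

(* Re log Z = log |Z|; since [ln 0 = 0], this is 0 instead of -oo where Z
   vanishes, which is a null event under Haar measure. *)
Definition relogZ (R : realType) (n : nat) (U : 'M[cplx R]_n) (theta : R) : R :=
  ln (ComplexField.Normc.normc (charpolyZ U theta)).

Section normalized.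
Context (R : realType) (n : nat) (d : measure_display) (T : measurableType d).
Context (P : probability T R) (U : T -> mxborel R n) (theta : R).

Definition sigma_relogZ : R :=
  Num.sqrt (fine 'V_P[fun w => relogZ (U w) theta]).

Definition normalizedZ (w : T) : R := relogZ (U w) theta / sigma_relogZ.

End normalized.

Definition standard_normal (R : realType) (d : measure_display)
    (T : measurableType d) (Q : probability T R) (N : {RV Q >-> R}) : Prop :=
  forall A : set R, measurable A -> distribution Q N A = normal_prob 0 1 A.

(* Main.v *)
(** Write [c] for the upper left entry of a Haar unitary matrix [M] of size
    [n + 1], and [W] for the matrix such that [1 - W] is the Schur complement of
    [1 - c] in [1 - M].  Then [W] is unitary, [det (1 - M) = (1 - c) det (1 - W)],
    and multiplying [M] on the left by [diag (1, V)] fixes [c] and turns [W] into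
    [V W].  By uniqueness of Haar measure, [W] is therefore Haar distributed on
    [U(n)] and independent of [c], so that [log |Z|] is a sum of [n] independent
    variables [log |1 - c_j|].

    The exact law of [c_j] is not needed: it is rotation invariant and
    [E |c_j|^2 = 1/j].  Rotation invariance alone gives [E log |1 - c_j| = 0],
    [E log^2 |1 - c_j| >= E |c_j|^2 / 32] and, for [m >= 2],
    [E |log |1 - c_j||^m <= K_m E |c_j|^2].  Hence the variance [s] of [log |Z|]
    is at least [log n / 32], and expanding the moments of the sum one summand at
    a time gives [E (log |Z|)^k = E N^k s^(k/2) + O(s^(k/2 - 1))] for even [k]. *)
Require Import Defs.
From HB Require Import structures.
From mathcomp Require Import all_boot all_order all_algebra.
From mathcomp Require Import complex.
From mathcomp Require Import all_classical all_reals all_analysis.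
From mathcomp Require Import measurable_realfun ring lra zify.
Set Implicit Arguments.
Unset Strict Implicit.
Unset Printing Implicit Defensive.
Import Order.TTheory GRing.Theory Num.Theory.
Import numFieldNormedType.Exports.
Local Open Scope classical_set_scope.
Local Open Scope ring_scope.
Local Open Scope sesquilinear_scope.

(** * Borel sets of matrices and their coordinates *)

(** The bounds on one factor are stated against [E |c_j|^2] so that every moment of order at least 2
    is at most a constant times the variance [v] of that factor. Passing from variance [s] to
    [t = s + v] then costs an error of order [v t^q], and [s^(q+1) + v t^q <= t^(q+1)]: the errors
    telescope, and one constant serves all sizes [n]. The obstacle is the singularity of
    [log |1 - z|] at 1, with no density to integrate against. Rotation invariance replaces the
    density: the disc of radius [4^-j / 8] about 1 has [4^j] disjoint rotated copies, so its mass is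
    at most [4^-j], whereas [e^(|log |1 - z|| / 2)] only reaches the order [2^j] on the
    corresponding annulus. Since [ln 0 = 0], the splitting of [log |det|] into a sum can fail where
    a factor vanishes, so these sets have to be shown null along the way. *)

Lemma measurable_bool_set (d : measure_display) (T : measurableType d)
    (p : T -> bool) :
  measurable_fun setT p -> measurable [set x | p x].
Proof.
move=> mp; have := mp measurableT [set true] I.
by rewrite setTI.
Qed.

Lemma normr_cplx_lt (R : realType) (z : cplx R) (e : R) :
  `|complex.Re z| < e / 2 -> `|complex.Im z| < e / 2 ->
  `|z| < (e%:C)%C :> cplx R.
Proof.
move=> hr hi; rewrite normc_def ltcR.
apply: (@le_lt_trans _ _ (`|complex.Re z| + `|complex.Im z|)); last first.
  by rewrite [e in _ < e](splitr e) ltrD.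
set t := `|_| + _; have t0 : 0 <= t by rewrite addr_ge0.
rewrite -(ger0_norm t0) -[leRHS]sqrtr_sqr ler_wsqrtr// /t.
by rewrite sqrrD !real_normK ?num_real// lerD2r lerDl mulrn_wge0// mulr_ge0.
Qed.

Section mxborel_coordinates.
Context (R : realType) (n : nat).

Lemma open_Re_gt (i j : 'I_n) (x : R) :
  open [set M : 'M[cplx R]_n | x < complex.Re (M i j)].
Proof.
rewrite openE => M /= xM; apply: (@coord_continuous (cplx R) n n i j M [set z : cplx R | x < complex.Re z]) => /=.
apply/(@nbhs_ballP (cplx R) (cplx R)).
exists ((complex.Re (M i j) - x)%:C)%C => /=; first by rewrite ltcR subr_gt0.
move=> z /= zM; have := le_lt_trans (normc_ge_Re _) zM.
rewrite ltcR raddfB /= => /(le_lt_trans (ler_norm _)).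
by rewrite ltrD2l ltrN2.
Qed.

Lemma open_Im_gt (i j : 'I_n) (x : R) :
  open [set M : 'M[cplx R]_n | x < complex.Im (M i j)].
Proof.
have ImRe (z : cplx R) : complex.Im z = complex.Re (- 'i * z).
  by rewrite -complexiE; case: z => a b; simpc.
rewrite openE => M /= xM; apply: (@coord_continuous (cplx R) n n i j M [set z : cplx R | x < complex.Im z]) => /=.
apply/(@nbhs_ballP (cplx R) (cplx R)).
exists ((complex.Im (M i j) - x)%:C)%C => /=; first by rewrite ltcR subr_gt0.
move=> z /= zM; have zM' : `|- 'i * (M i j - z)| < ((complex.Im (M i j) - x)%:C)%C :> cplx R.
  by rewrite normrM normrN normCi mul1r.
have := le_lt_trans (normc_ge_Re _) zM'.
rewrite ltcR -ImRe raddfB /= => /(le_lt_trans (ler_norm _)).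
by rewrite ltrD2l ltrN2.
Qed.

Lemma measurable_Re_coord (i j : 'I_n) :
  measurable_fun setT (fun M : mxborel R n => complex.Re (M i j) : R).
Proof.
apply: (measurability _ (RGenOInfty.measurableE R)) => _ [_ [x ->] <-].
rewrite setTI preimage_itvoy; apply: sub_sigma_algebra; exact: open_Re_gt.
Qed.

Lemma measurable_Im_coord (i j : 'I_n) :
  measurable_fun setT (fun M : mxborel R n => complex.Im (M i j) : R).
Proof.
apply: (measurability _ (RGenOInfty.measurableE R)) => _ [_ [x ->] <-].
rewrite setTI preimage_itvoy; apply: sub_sigma_algebra; exact: open_Im_gt.
Qed.

(** A countable base of the matrix topology. The Borel sets are generated by open sets, and
    countability of the index type is what lets every open set be recovered from conditions on the
    real and imaginary parts of the entries. *)
Definition ratbox (p : {ffun 'I_n * 'I_n -> rat * rat} * nat) :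
    set 'M[cplx R]_n :=
  [set M | forall i j,
    `|complex.Re (M i j) - ratr (p.1 (i, j)).1| < p.2.+1%:R^-1 /\
    `|complex.Im (M i j) - ratr (p.1 (i, j)).2| < p.2.+1%:R^-1].

Lemma open_bigcup_ratbox (A : set 'M[cplx R]_n) : open A ->
  A = \bigcup_(p in [set p | ratbox p `<=` A]) ratbox p.
Proof.
move=> oA; apply/seteqP; split; last by move=> M [p]; exact.
move=> M AM; have : nbhs M A by move: oA; rewrite openE; exact.
move=> /(@nbhs_ballP (cplx R) 'M[cplx R]_n) -[[e e'] /= e0 MA].
(* Radii of balls are elements of [cplx R]; being positive forces the imaginary part to vanish. *)
have [{}e0 e'0] : 0 < e /\ e' = 0.
  by move: e0; rewrite ltcE /= => /andP[/eqP -> ->].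
subst e'.
(* Two points of a box are each within [e / 4] of its centre, so their real and imaginary parts
   differ by less than [e / 2], as [normr_cplx_lt] requires. *)
have [k ke] : exists k : nat, k.+1%:R^-1 < e / 4.
  have [k _ ke] := near_infty_natSinv_lt (PosNum (divr_gt0 e0 (ltr0n R 4))).
  by exists k; exact: ke (leqnn k).
have k0 : 0 < k.+1%:R^-1 :> R by rewrite invr_gt0.
have apx (x : R) : {q : rat | `|x - ratr q| < k.+1%:R^-1}.
  apply: cid; have [|q] := @rat_in_itvoo R (x - k.+1%:R^-1) (x + k.+1%:R^-1).
    by rewrite ltrD2l gtrN.
  rewrite in_itv/= => /andP[q1 q2]; exists q; rewrite ltr_distlC.
  by rewrite q1.
pose p := ([ffun ij : 'I_n * 'I_n => (sval (apx (complex.Re (M ij.1 ij.2))),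
   sval (apx (complex.Im (M ij.1 ij.2))))], k).
have Mp : ratbox p M.
  by move=> i j /=; rewrite ffunE /=; split; [exact: (svalP (apx _))|exact: (svalP (apx _))].
exists p => //= N Np; apply: MA; split; first by rewrite ltcR.
move=> i j; have [Nr Ni] := Np i j; have [Mr Mi] := Mp i j.
have tri (x y z : R) : `|x - z| < k.+1%:R^-1 -> `|y - z| < k.+1%:R^-1 -> `|x - y| < e / 2.
  move=> xz yz; rewrite -(subrKA z) (le_lt_trans (ler_normD _ _))//.
  have -> : e / 2 = e / 4 + e / 4 by field.
  apply: ltrD; first exact: lt_trans ke.
  by rewrite distrC; exact: lt_trans ke.
by apply: normr_cplx_lt; rewrite raddfB/=; [exact: tri Mr Nr|exact: tri Mi Ni].
Qed.

Lemma measurable_to_mxborel (d : measure_display) (T : measurableType d)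
    (f : T -> mxborel R n) :
  (forall i j, measurable_fun setT (fun x => complex.Re (f x i j) : R)) ->
  (forall i j, measurable_fun setT (fun x => complex.Im (f x i j) : R)) ->
  measurable_fun setT f.
Proof.
move=> fr fi; apply: (@measurability _ _ T (mxborel R n) setT f (@open 'M[cplx R]_n) erefl).
move=> _ [A oA <-].
rewrite setTI (open_bigcup_ratbox oA) preimage_bigcup bigcup_mkcond.
apply: countable_bigcupT_measurable => // p; case: ifP => // _.
have -> : f @^-1` ratbox p = \bigcap_(ij in [set: 'I_n * 'I_n])
    ([set x | `|complex.Re (f x ij.1 ij.2) - ratr (p.1 ij).1| < p.2.+1%:R^-1] `&`
     [set x | `|complex.Im (f x ij.1 ij.2) - ratr (p.1 ij).2| < p.2.+1%:R^-1]).
  apply/seteqP; split => x /= fx; first by move=> [i j] _; exact: fx.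
  by move=> i j; exact: (fx (i, j)).
apply: fin_bigcap_measurable => // ij _.
have mlt (h : T -> R) (c e : R) : measurable_fun setT h ->
    measurable [set x | `|h x - c| < e].
  move=> mh.
  have mhc : measurable_fun setT (fun x => `|h x - c|).
    by apply: measurableT_comp => //; exact: measurable_funB.
  exact/measurable_bool_set/measurable_fun_ltr.
by apply: measurableI; exact: mlt.
Qed.

End mxborel_coordinates.

(** * Measurability of complex-valued and matrix-valued maps *)

Section complex_measurability.
Context (R : realType) (d : measure_display) (T : measurableType d).
Implicit Types f g : T -> cplx R.

Definition cmeasurable f :=
  measurable_fun setT (fun x => complex.Re (f x) : R) /\
  measurable_fun setT (fun x => complex.Im (f x) : R).

Lemma cmeasurable_cst (c : cplx R) : cmeasurable (fun=> c).
Proof. by split; exact: measurable_cst. Qed.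

Lemma cmeasurableD f g :
  cmeasurable f -> cmeasurable g -> cmeasurable (fun x => f x + g x).
Proof.
move=> [fr fi] [gr gi]; split.
- rewrite (_ : (fun x => _) = (fun x => complex.Re (f x)) \+ (fun x => complex.Re (g x))).
    exact: measurable_funD.
  by apply/funext => x; rewrite raddfD.
- rewrite (_ : (fun x => _) = (fun x => complex.Im (f x)) \+ (fun x => complex.Im (g x))).
    exact: measurable_funD.
  by apply/funext => x; rewrite raddfD.
Qed.

Lemma cmeasurableM f g :
  cmeasurable f -> cmeasurable g -> cmeasurable (fun x => f x * g x).
Proof.
move=> [fr fi] [gr gi]; split.
- rewrite (_ : (fun x => _) =
      (fun x => complex.Re (f x)) \* (fun x => complex.Re (g x)) \-
      (fun x => complex.Im (f x)) \* (fun x => complex.Im (g x))).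
    by apply: measurable_funB; exact: measurable_funM.
  by apply/funext => x /=; case: (f x) => a b; case: (g x).
- rewrite (_ : (fun x => _) =
      (fun x => complex.Re (f x)) \* (fun x => complex.Im (g x)) \+
      (fun x => complex.Im (f x)) \* (fun x => complex.Re (g x))).
    by apply: measurable_funD; exact: measurable_funM.
  by apply/funext => x /=; case: (f x) => a b; case: (g x).
Qed.

Lemma cmeasurableN f : cmeasurable f -> cmeasurable (fun x => - f x).
Proof.
move=> mf; rewrite (_ : (fun x => _) = (fun x => -1 * f x)).
  exact/cmeasurableM/mf/cmeasurable_cst.
by apply/funext => x; rewrite mulN1r.
Qed.

Lemma cmeasurableB f g :
  cmeasurable f -> cmeasurable g -> cmeasurable (fun x => f x - g x).
Proof. by move=> mf mg; exact/cmeasurableD/cmeasurableN. Qed.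

Lemma cmeasurable_conj f : cmeasurable f -> cmeasurable (fun x => Num.conj (f x)).
Proof.
move=> [fr fi]; split.
- rewrite (_ : (fun x => _) = (fun x => complex.Re (f x))) //.
  by apply/funext => x /=; case: (f x).
- rewrite (_ : (fun x => _) = (fun x => - complex.Im (f x))).
    exact: measurableT_comp.
  by apply/funext => x /=; case: (f x).
Qed.

Lemma measurable_sqr_modulus f : cmeasurable f ->
  measurable_fun setT (fun x => complex.Re (f x) ^+ 2 + complex.Im (f x) ^+ 2).
Proof.
by move=> [fr fi]; apply: measurable_funD; exact: measurable_funX.
Qed.

Lemma cmeasurableV f : cmeasurable f -> cmeasurable (fun x => (f x)^-1).
Proof.
move=> mf.
have mV : measurable_fun setT
    (fun x => (complex.Re (f x) ^+ 2 + complex.Im (f x) ^+ 2)^-1 : R).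
  (* Inversion is read as the power [-1]; the two agree on nonnegative reals, both being 0 at 0. *)
  rewrite (_ : (fun x => _) =
    (@powR R ^~ (-1)) \o (fun x => complex.Re (f x) ^+ 2 + complex.Im (f x) ^+ 2)).
    exact/(measurableT_comp (measurable_powR (-1)))/measurable_sqr_modulus.
  by apply/funext => x /=; rewrite powR_inv1// addr_ge0// sqr_ge0.
case: mf => fr fi; split.
- rewrite (_ : (fun x => _) = (fun x => complex.Re (f x)) \*
      (fun x => (complex.Re (f x) ^+ 2 + complex.Im (f x) ^+ 2)^-1)).
    exact: measurable_funM.
  by apply/funext => x /=; case: (f x).
- rewrite (_ : (fun x => _) = (fun x => - complex.Im (f x)) \*
      (fun x => (complex.Re (f x) ^+ 2 + complex.Im (f x) ^+ 2)^-1)).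
    by apply: measurable_funM => //; exact: measurableT_comp.
  by apply/funext => x /=; case: (f x) => a b /=; rewrite mulNr.
Qed.

Lemma cmeasurable_sum (I : Type) (s : seq I) (P : pred I) (f : I -> T -> cplx R) :
  (forall i, cmeasurable (f i)) ->
  cmeasurable (fun x => \sum_(i <- s | P i) f i x).
Proof.
move=> mf; elim: s => [|i s ih].
  by rewrite (_ : (fun x => _) = fun=> 0 : cplx R); [exact: cmeasurable_cst|
    apply/funext => x; rewrite big_nil].
rewrite (_ : (fun x => _) = fun x => (if P i then f i x else 0) +
    \sum_(i <- s | P i) f i x); last first.
  by apply/funext => x; rewrite big_cons; case: ifP => //; rewrite add0r.
by apply: cmeasurableD => //; case: (P i) => //; exact: cmeasurable_cst.
Qed.

Lemma cmeasurable_prod (I : Type) (s : seq I) (P : pred I) (f : I -> T -> cplx R) :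
  (forall i, cmeasurable (f i)) ->
  cmeasurable (fun x => \prod_(i <- s | P i) f i x).
Proof.
move=> mf; elim: s => [|i s ih].
  by rewrite (_ : (fun x => _) = fun=> 1 : cplx R); [exact: cmeasurable_cst|
    apply/funext => x; rewrite big_nil].
rewrite (_ : (fun x => _) = fun x => (if P i then f i x else 1) *
    \prod_(i <- s | P i) f i x); last first.
  by apply/funext => x; rewrite big_cons; case: ifP => //; rewrite mul1r.
by apply: cmeasurableM => //; case: (P i) => //; exact: cmeasurable_cst.
Qed.

Lemma cmeasurable_eq f (c : cplx R) : cmeasurable f ->
  measurable [set x | f x = c].
Proof.
move=> [fr fi]; rewrite (_ : mkset _ =
    [set x | complex.Re (f x) == complex.Re c] `&`
    [set x | complex.Im (f x) == complex.Im c]).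
  by apply: measurableI; apply/measurable_bool_set/measurable_fun_eqr => //;
    exact: measurable_cst.
apply/seteqP; split => x /=; first by move->.
by case: (f x) c => a b [a' b'] /= [/eqP -> /eqP ->].
Qed.

End complex_measurability.

Section mxborel_measurability.
Context (R : realType) (d : measure_display) (T : measurableType d).

Lemma cmeasurable_coord (n : nat) (f : T -> mxborel R n) (i j : 'I_n) :
  measurable_fun setT f -> cmeasurable (fun x => f x i j : cplx R).
Proof.
move=> mf; split.
- exact: (measurableT_comp (measurable_Re_coord i j) mf).
- exact: (measurableT_comp (measurable_Im_coord i j) mf).
Qed.

Lemma measurable_mxborel (n : nat) (f : T -> mxborel R n) :
  (forall i j, cmeasurable (fun x => f x i j : cplx R)) -> measurable_fun setT f.
Proof. by move=> mf; apply: measurable_to_mxborel => i j; case: (mf i j). Qed.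

Lemma measurable_mulmx (n : nat) (f g : T -> mxborel R n) :
  measurable_fun setT f -> measurable_fun setT g ->
  measurable_fun setT (fun x => f x *m g x : mxborel R n).
Proof.
move=> mf mg; apply: measurable_mxborel => i j.
rewrite (_ : (fun x => _) = fun x => \sum_k (f x : 'M[cplx R]_n) i k * (g x : 'M[cplx R]_n) k j).
  by apply: cmeasurable_sum => k; apply: cmeasurableM; exact: cmeasurable_coord.
by apply/funext => x; rewrite mxE.
Qed.

Lemma measurable_adjmx (n : nat) (f : T -> mxborel R n) :
  measurable_fun setT f ->
  measurable_fun setT (fun x => (f x : 'M[cplx R]_n)^t* : mxborel R n).
Proof.
move=> mf; apply: measurable_mxborel => i j.
rewrite (_ : (fun x => _) = fun x => Num.conj ((f x : 'M[cplx R]_n) j i)).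
  exact/cmeasurable_conj/cmeasurable_coord.
by apply/funext => x; rewrite !mxE.
Qed.

Lemma cmeasurable_det (n : nat) (f : T -> mxborel R n) :
  measurable_fun setT f -> cmeasurable (fun x => \det (f x : 'M[cplx R]_n)).
Proof.
move=> mf; apply: cmeasurable_sum => s; apply: cmeasurableM.
  exact: cmeasurable_cst.
by apply: cmeasurable_prod => i; exact: cmeasurable_coord.
Qed.

End mxborel_measurability.

Lemma measurable_unitary_group (R : realType) (n : nat) :
  measurable (unitary_group R n : set (mxborel R n)).
Proof.
rewrite (_ : unitary_group R n = \bigcap_(ij in [set: 'I_n * 'I_n])
  [set M : mxborel R n | (M *m (M : 'M[cplx R]_n)^t*) ij.1 ij.2 =
    (1%:M : 'M[cplx R]_n) ij.1 ij.2]); last first.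
  apply/seteqP; split => M /=.
    by move/unitarymxP => MM ij _ /=; rewrite MM.
  by move=> MM; apply/unitarymxP/matrixP => i j; exact: (MM (i, j)).
apply: fin_bigcap_measurable => // ij _; apply: cmeasurable_eq.
apply: cmeasurable_coord; apply: measurable_mulmx => //.
exact: measurable_adjmx.
Qed.

(** * Left invariant measures on the unitary group *)

Section left_invariance.
Context (R : realType) (n : nat).
Local Notation X := (mxborel R n).
Implicit Types mu nu : {finite_measure set X -> \bar R}.

(** Haar invariance restated with preimages and for all Borel sets, which is the form that integrals
    use. It makes sense for any set function, because it is also applied to measures of total mass
    below 1. *)
Definition left_invariant (mu : set X -> \bar R) : Prop :=
  mu (~` unitary_group R n) = 0%E /\
  forall (V : 'M[cplx R]_n) (B : set X), V \is unitarymx -> measurable B ->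
    mu [set M : X | B (V *m M)] = mu B.

Lemma measurable_mulmxl (V : 'M[cplx R]_n) :
  measurable_fun setT (fun M : X => V *m M : X).
Proof. exact: measurable_mulmx. Qed.

Lemma measurable_preimage (d : measure_display) (T : measurableType d)
    (d' : measure_display) (T' : measurableType d') (f : T -> T') (B : set T') :
  measurable_fun setT f -> measurable B -> measurable [set x | B (f x)].
Proof. by move=> mf mB; rewrite -[X in measurable X]setTI; exact: mf. Qed.

Lemma measure_setI_unitary mu (B : set X) :
  mu (~` unitary_group R n) = 0%E -> measurable B ->
  mu (B `&` unitary_group R n) = mu B.
Proof.
move=> mu0 mB; have mU := @measurable_unitary_group R n.
rewrite [in RHS](measureDI mu mB mU) [X in (X + _)%E](_ : _ = 0%E) ?add0e//.
apply/eqP; rewrite -measure_le0 -mu0.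
apply: le_measure; rewrite ?inE; last by move=> ? [].
- exact: measurableD.
- exact: measurableC.
Qed.

(** Any unitary [M] is [V (V^* M)], so [V] maps the unitary part of the preimage of [B] onto the
    unitary part of [B]; what lies outside [U(n)] has mass 0. *)
Lemma haar_left_invariant (mu : probability X R) :
  haar_unitary mu -> left_invariant mu.
Proof.
move=> [mu1 muV]; have mU := @measurable_unitary_group R n.
have mu0 : mu (~` unitary_group R n) = 0%E.
  by rewrite probability_setC// mu1 subee.
split=> // V B VU mB.
have mVB := measurable_preimage (measurable_mulmxl V) mB.
rewrite -(measure_setI_unitary mu0 mB) -(measure_setI_unitary mu0 mVB).
apply: (etrans (esym (muV V _ VU _ _))) => //; first exact: measurableI.
congr (mu _); apply/seteqP; split.
  move=> _ [M [BVM MU] <-]; split; first exact: BVM.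
  exact: (mul_unitarymx VU MU).
move=> M [BM MU]; have VVM : V *m (V^t* *m M) = M.
  by rewrite mulmxA (unitarymxP VU) mul1mx.
exists (V^t* *m M); last exact: VVM.
split; first by rewrite /= VVM.
by apply: (mul_unitarymx _ MU); rewrite trmxC_unitary.
Qed.

Lemma ae_unitary mu : mu (~` unitary_group R n) = 0%E ->
  {ae mu, forall M : X, (M : 'M[cplx R]_n) \is unitarymx}.
Proof.
move=> mu0; exists (~` unitary_group R n); split => //.
by apply: measurableC; exact: measurable_unitary_group.
Qed.

(* Both sides are [\int\int \1_B (g^* h) d mu(h) d nu(g)]. *)
Lemma left_invariant_adj mu nu (B : set X) :
  left_invariant mu -> left_invariant nu -> measurable B ->
  (mu B * nu setT = nu [set M : X | B ((M : 'M[cplx R]_n)^t*)] * mu setT)%E.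
Proof.
move=> [mu0 muV] [nu0 nuV] mB.
pose f (gh : X * X) : \bar R := (\1_B ((gh.1 : 'M[cplx R]_n)^t* *m gh.2 : X))%:E.
have mf : measurable_fun setT f.
  apply/measurable_EFinP; apply: (measurableT_comp (measurable_indic mB)).
  by apply: measurable_mulmx => //; exact: measurable_adjmx.
have f0 x : (0 <= f x)%E by rewrite lee_fin.
have := @fubini_tonelli _ _ _ _ R nu mu f mf f0.
have inner1 (g : X) : (\int[mu]_h f (g, h) =
    mu [set M : X | B ((g : 'M[cplx R]_n)^t* *m M)])%E.
  rewrite -[X in _ = _ X]setIT -integral_indic//.
  exact: (measurable_preimage (measurable_mulmxl _) mB).
have inner2 (h : X) : (\int[nu]_g f (g, h) =
    nu [set M : X | B ((M : 'M[cplx R]_n)^t* *m h)])%E.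
  rewrite -[X in _ = _ X]setIT -integral_indic//.
  apply: (@measurable_preimage _ _ _ _ (fun M : X => (M : 'M[cplx R]_n)^t* *m h : X)) => //.
  by apply: measurable_mulmx => //; exact: measurable_adjmx.
have mB' : measurable [set M : X | B ((M : 'M[cplx R]_n)^t*)].
  apply: (@measurable_preimage _ _ _ _ (fun M : X => (M : 'M[cplx R]_n)^t* : X)) => //.
  exact: measurable_adjmx.
rewrite (@ae_eq_integral _ _ _ nu setT (cst (mu B))) //; last 2 first.
- exact: (@measurable_fun_fubini_tonelli_F _ _ _ _ R mu f).
- apply: filterS (ae_unitary nu0) => g gU _; rewrite inner1.
  by apply: (muV _ _ _ mB); rewrite trmxC_unitary.
rewrite integral_cst// => ->.
rewrite (@ae_eq_integral _ _ _ mu setT (cst (nu [set M : X | B ((M : 'M[cplx R]_n)^t*)]))) //; last 2 first.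
- exact: (@measurable_fun_fubini_tonelli_G _ _ _ _ R nu f).
- apply: filterS (ae_unitary mu0) => h hU _ /=; rewrite inner2.
  rewrite -[RHS](nuV (h^t*)) ?trmxC_unitary//; congr (nu _).
  by apply/seteqP; split => M /=; rewrite trmx_mul map_mxM /= trmxCK.
by rewrite integral_cst.
Qed.

End left_invariance.

(** * The Schur complement of the upper left entry *)

Section schur_complement.
Context (C : numClosedFieldType) (n : nat).
Implicit Types M : 'M[C]_(1 + n).

(* [1 - cayley_minor M] is the Schur complement of the upper left entry in
   [1 - M]. *)
Definition cayley_minor M : 'M[C]_n :=
  drsubmx M + (1 - M 0 0)^-1 *: (dlsubmx M *m ursubmx M).

Lemma det_1_sub_cayley_minor M : M 0 0 != 1 ->
  \det (1%:M - M) = (1 - M 0 0) * \det (1%:M - cayley_minor M).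
Proof.
move=> M1; have a0 : 1 - M 0 0 != 0 by rewrite subr_eq0 eq_sym.
have E : 1%:M - M = block_mx (1 - M 0 0)%:M (- ursubmx M) (- dlsubmx M) (1%:M - drsubmx M).
  rewrite -{1}[M]submxK (scalar_mx_block 1 n) opp_block_mx add_block_mx !add0r.
  congr block_mx; apply/matrixP => i j; rewrite !mxE !ord1 mulr1n.
  by congr (_ - M _ _); apply/val_inj.
(* [L] is the block elimination that clears the lower left block of [1 - M]; it has determinant
   1. *)
pose L : 'M[C]_(1 + n) := block_mx 1%:M 0 ((1 - M 0 0)^-1 *: dlsubmx M) 1%:M.
have detL : \det L = 1 by rewrite det_lblock !det1 mulr1.
transitivity (\det (L *m (1%:M - M))); first by rewrite det_mulmx detL mul1r.
rewrite E mulmx_block !mul1mx !mul0mx !addr0.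
rewrite mul_mx_scalar scalerA mulfV// scale1r subrr det_ublock det_scalar1.
congr (_ * \det _); rewrite /cayley_minor mulmxN scalemxAl opprD addrC.
by rewrite -!addrA.
Qed.

(** Conceptually, [M] sends [(x, y)] to [(x, W y)] when [x = (1 - a)^-1 b y], and an isometry lets
    [|x|^2] cancel. The computation uses the blocks of [M M^* = 1]: after substituting [b b^*] and
    [D b^*], the coefficient of [c c^*] in [W W^*] collapses to 1, leaving the lower right block of
    [M M^*]. *)
Lemma cayley_minor_unitary M : M 0 0 != 1 -> M \is unitarymx ->
  cayley_minor M \is unitarymx.
Proof.
move=> M1 /unitarymxP MM; have a0 : 1 - M 0 0 != 0 by rewrite subr_eq0 eq_sym.
set a := M 0 0 in a0 *; set b := ursubmx M; set c := dlsubmx M; set D := drsubmx M.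
have a0' : 1 - a^* != 0 by rewrite -(rmorph1 Num.conj) -rmorphB conjC_eq0.
have Mb : M = block_mx a%:M b c D.
  rewrite -{1}[M]submxK; congr block_mx; apply/matrixP => i j.
  by rewrite !mxE !ord1 mulr1n; congr (M _ _); apply/val_inj.
rewrite /cayley_minor -/a -/b -/c -/D; clearbody a b c D.
move: MM; rewrite Mb tr_block_mx map_block_mx mulmx_block (scalar_mx_block 1 n).
rewrite tr_scalar_mx map_scalar_mx /= => /eq_block_mx[h1 _ h3 h4].
have {}h3 : D *m b^t* = - a^* *: c.
  by apply/eqP; rewrite scaleNr -addr_eq0 addrC -mul_mx_scalar h3.
have h3' : b *m D^t* = - a *: c^t*.
  have := congr1 (fun A => A^t*) h3; rewrite trmx_mul map_mxM /= trmxCK => ->.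
  by rewrite linearZ /= map_mxZ rmorphN /= conjCK.
have {}h1 : b *m b^t* = (1 - a * a^*)%:M.
  by rewrite raddfB /= -h1 scalar_mxM addrC addKr.
apply/unitarymxP.
rewrite linearD linearZ /= trmx_mul map_mxD map_mxZ map_mxM /=.
rewrite fmorphV rmorphB rmorph1 /= mulmxDl !mulmxDr.
rewrite -!scalemxAl -!scalemxAr [D *m (_ *m _)]mulmxA h3 -[c *m b *m D^t*]mulmxA h3'.
rewrite -!scalemxAl -!scalemxAr [c *m b *m _]mulmxA -(mulmxA c b) h1.
rewrite mul_mx_scalar -!scalemxAl !scalerA.
rewrite -!addrA -!scalerDl -[RHS]h4 addrC; congr (_ + _).
rewrite -[RHS]scale1r; congr (_ *: _).
by field; rewrite a0 a0'.
Qed.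

Lemma block_mulmx00 (W : 'M[C]_n) M : (block_mx 1%:M 0 0 W *m M) 0 0 = M 0 0.
Proof.
have e : (0 : 'I_(1 + n)) = lshift n 0 by exact/val_inj.
rewrite -{1}[M]submxK mulmx_block !mul1mx !mul0mx !addr0 e block_mxEul !mxE.
by rewrite -e.
Qed.

Lemma cayley_minor_mulmx (W : 'M[C]_n) M :
  cayley_minor (block_mx 1%:M 0 0 W *m M) = W *m cayley_minor M.
Proof.
rewrite /cayley_minor block_mulmx00 -[X in _ *m X]submxK mulmx_block.
rewrite !mul1mx !mul0mx !add0r !addr0.
by rewrite block_mxKdr block_mxKdl block_mxKur mulmxDr -scalemxAr mulmxA.
Qed.

Lemma block_unitarymx (W : 'M[C]_n) :
  W \is unitarymx -> (block_mx 1%:M 0 0 W : 'M[C]_(1 + n)) \is unitarymx.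
Proof.
move=> /unitarymxP WW; apply/unitarymxP.
rewrite tr_block_mx map_block_mx mulmx_block !trmx0 !map_mx0 !mul0mx !mulmx0.
by rewrite !addr0 !add0r trmx1 map_mx1 mul1mx WW -scalar_mx_block.
Qed.

End schur_complement.

(** * Law of the Schur complement and its independence of the corner *)

Section restricted_law.
Context (R : realType) (d d' : measure_display).
Context (T : measurableType d) (T' : measurableType d').
Context (mu : probability T R) (A : set T) (mA : measurable A).
Context (f : T -> T') (mf : measurable_fun setT f).

(** Image under [f] of [mu] restricted to [A], an unnormalized conditional law of mass [mu A]. The
    two proofs are arguments so that the finite measure structure can be inferred from the term. *)
Definition restricted_law & measurable A & measurable_fun setT f :
  set T' -> \bar R := fun B => mu (A `&` [set x | B (f x)]).

Local Notation law := (restricted_law mA mf).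

Let mpre (B : set T') : measurable B -> measurable (A `&` [set x | B (f x)]).
Proof. by move=> mB; apply: measurableI => //; exact: measurable_preimage. Qed.

Let law0 : law set0 = 0%E.
Proof. by rewrite /restricted_law (_ : _ `&` _ = set0) ?measure0// -subset0 => ? []. Qed.

Let law_ge0 B : (0 <= law B)%E. Proof. exact: measure_ge0. Qed.

Let law_sigma_additive : semi_sigma_additive law.
Proof.
move=> F mF tF mUF; rewrite /restricted_law.
rewrite (_ : A `&` _ = \bigcup_i (A `&` [set x | F i (f x)])); last first.
  by rewrite -setI_bigcupr.
apply: measure_semi_sigma_additive.
- by move=> i; exact: mpre.
- apply/trivIsetP => i j _ _ ij.
  rewrite setIACA setIid (_ : [set x | F i (f x)] `&` _ = set0) ?setI0//.
  move/trivIsetP : tF => /(_ _ _ I I ij); rewrite -!subset0 => FF x [] Fi Fj.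
  exact: FF (f x) (conj Fi Fj).
- by apply: bigcupT_measurable => i; exact: mpre.
Qed.

HB.instance Definition _ := isMeasure.Build _ _ _ law law0 law_ge0 law_sigma_additive.

Let law_finite : fin_num_fun law.
Proof. by move=> B mB; rewrite fin_num_measure//; exact: mpre. Qed.

HB.instance Definition _ := @Measure_isFinite.Build _ _ _ law law_finite.

End restricted_law.

Section cayley_minor_law.
Context (R : realType) (n : nat).
Local Notation X := (mxborel R n.+1).
Local Notation Y := (mxborel R n).
Context (mu : probability X R) (muinv : left_invariant mu).
Hypothesis mu1 : mu [set M : X | (M : 'M[cplx R]_n.+1) 0 0 = 1] = 0%E.

Definition cayley_fun (M : X) : Y := @cayley_minor (cplx R) n M.

Lemma measurable_cayley_fun : measurable_fun setT cayley_fun.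
Proof.
apply: measurable_mxborel => i j.
have mc (k l : 'I_(1 + n)) : cmeasurable (fun M : X => (M : 'M[cplx R]_n.+1) k l).
  exact: cmeasurable_coord.
rewrite (_ : (fun M => _) = fun M : X =>
    (M : 'M[cplx R]_(1 + n)) (rshift 1 i) (rshift 1 j) +
    (1 - (M : 'M[cplx R]_(1 + n)) 0 0)^-1 *
    ((M : 'M[cplx R]_(1 + n)) (rshift 1 i) (lshift n 0) *
     (M : 'M[cplx R]_(1 + n)) (lshift n 0) (rshift 1 j))).
  apply: cmeasurableD; first exact: mc.
  apply: cmeasurableM; last by apply: cmeasurableM; exact: mc.
  by apply/cmeasurableV/cmeasurableB; [exact: cmeasurable_cst|exact: mc].
by apply/funext => M; rewrite /cayley_fun /cayley_minor !mxE big_ord1 !mxE.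
Qed.

HB.instance Definition _ := isMeasurableFun.Build _ _ _ _ cayley_fun measurable_cayley_fun.

Definition cayley_law : probability Y R := distribution mu cayley_fun.

(** Independence in disguise: multiplication by [diag(1, W)] preserves [mu] and the event [A] and
    multiplies the minor by [W], so conditioning on [A] keeps the law of the minor left invariant.
    The minor is unitary outside the null events [M 0 0 = 1] and [M] not unitary. *)
Lemma restricted_cayley_law_left_invariant (A : set X) (mA : measurable A) :
  (forall (W : 'M[cplx R]_n) (M : X), W \is unitarymx ->
    A (block_mx 1%:M 0 0 W *m (M : 'M[cplx R]_(1 + n))) <-> A M) ->
  left_invariant (restricted_law mu mA measurable_cayley_fun).
Proof.
case: (muinv) => mu0 muV Ainv; split.
  apply/eqP; rewrite -measure_le0.
  have mU' := @measurable_unitary_group R n.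
  have mU := @measurable_unitary_group R n.+1.
  have m1 : measurable [set M : X | (M : 'M[cplx R]_n.+1) 0 0 = 1].
    by apply: cmeasurable_eq; exact: cmeasurable_coord.
  apply: (@le_trans _ _ (mu ([set M : X | (M : 'M[cplx R]_n.+1) 0 0 = 1] `|` ~` unitary_group R n.+1))); last first.
    apply: (le_trans (measureU2 _ _ _)) => //; first exact: measurableC.
    by rewrite [X in (X + _)%E]mu1 [X in (_ + X)%E]mu0 adde0.
  apply: le_measure; rewrite ?inE.
  - apply: measurableI => //; apply: (measurable_preimage measurable_cayley_fun); exact: measurableC.
  - by apply: measurableU => //; exact: measurableC.
  - move=> M [_ /= nU]; have [M1|M1] := eqVneq ((M : 'M[cplx R]_n.+1) 0 0) 1; first by left.
    by right=> MU; apply: nU; exact: cayley_minor_unitary.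
move=> W B WU mB; rewrite /restricted_law.
rewrite -[RHS](muV (block_mx 1%:M 0 0 W : 'M[cplx R]_(1 + n))); last 2 first.
- exact: block_unitarymx.
- apply: measurableI => //; exact: (measurable_preimage measurable_cayley_fun mB).
congr (mu _); apply/seteqP; split => M /= [AM BM]; split.
- exact/Ainv.
- by rewrite /cayley_fun cayley_minor_mulmx.
- by apply/Ainv; first exact: WU.
- by move: BM; rewrite /cayley_fun cayley_minor_mulmx.
Qed.

Lemma cayley_law_left_invariant : left_invariant cayley_law.
Proof.
have [] := @restricted_cayley_law_left_invariant setT measurableT.
  by [].
have E B : restricted_law mu measurableT measurable_cayley_fun B = cayley_law B.
  by rewrite /restricted_law setTI.
move=> h1 h2; split; first by rewrite -E.
by move=> V B VU mB; rewrite -!E; exact: h2.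
Qed.

(** The restricted and the full law of the minor are both left invariant. Comparing each with the
    full law through [left_invariant_adj] expresses both by the same value on adjoints, so they are
    proportional, with ratio [mu A]. *)
Lemma cayley_minor_independent (A : set X) (B : set Y) :
  measurable A -> measurable B ->
  (forall (W : 'M[cplx R]_n) (M : X), W \is unitarymx ->
    A (block_mx 1%:M 0 0 W *m (M : 'M[cplx R]_(1 + n))) <-> A M) ->
  mu (A `&` cayley_fun @^-1` B) = (mu A * cayley_law B)%E.
Proof.
move=> mA mB Ainv.
have h := restricted_cayley_law_left_invariant mA Ainv.
have e1 := left_invariant_adj h cayley_law_left_invariant mB.
have e2 := left_invariant_adj cayley_law_left_invariant cayley_law_left_invariant mB.
have T1 : cayley_law setT = 1%E := @probability_setT _ _ _ cayley_law.
move: e1 e2; rewrite [X in (_ * X = _)%E -> _]T1 !mule1 => e1.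
rewrite [X in (_ * X = _)%E -> _]T1 [X in (_ = _ * X)%E -> _]T1 !mule1 => e2.
move: e1; rewrite -[X in (_ = X * _)%E -> _]e2 => e1.
rewrite muleC; apply: (etrans e1); congr (_ * mu _)%E; exact: setIT.
Qed.

End cayley_minor_law.

(** * The function log |1 - z| on the unit disc *)

Section log_modulus.
Context (R : realType).
Implicit Types (p : R * R) (x y s : R).

Definition sqmod p : R := p.1 ^+ 2 + p.2 ^+ 2.

Definition sqdist1 p : R := (1 - p.1) ^+ 2 + p.2 ^+ 2.

(* [log |1 - (p.1 + i p.2)|] *)
Definition logmod p : R := ln (sqdist1 p) / 2.

Lemma sqmod_ge0 p : 0 <= sqmod p. Proof. by rewrite addr_ge0// sqr_ge0. Qed.

Lemma sqdist1_ge0 p : 0 <= sqdist1 p. Proof. by rewrite addr_ge0// sqr_ge0. Qed.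

Lemma sqmod_fst_bound p : sqmod p <= 1 -> -1 <= p.1 <= 1.
Proof. by case: p => x y; rewrite /sqmod /= => h; apply/andP; split; nra. Qed.

Lemma sqdist1_le4 p : sqmod p <= 1 -> sqdist1 p <= 4.
Proof.
move=> h; have /andP[] := sqmod_fst_bound h; move: h.
case: p => x y; rewrite /sqmod /sqdist1 /=; nra.
Qed.

Lemma ln_ge1BV x : 0 < x -> 1 - x^-1 <= ln x.
Proof.
move=> x0; rewrite -lerN2 -lnV ?posrE// opprB.
have := @le_ln1Dx R (x^-1 - 1); rewrite addrCA subrr addr0; apply.
by rewrite ltrBrDl subrr invr_gt0.
Qed.

Lemma ln2_ge : 2^-1 <= ln 2 :> R.
Proof. by have := @ln_ge1BV 2 (ltr0n _ 2); lra. Qed.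

Lemma ln2_le1 : ln 2 <= 1 :> R.
Proof. by have := @le_ln1Dx R 1; rewrite (_ : 1 + 1 = 2)//; apply; lra. Qed.

(** With [r = |z| < 1/2], [|1 - z|] lies between [1 - r] and [1 + r], whose logarithms lie in
    [[-2r, r]]. *)
Lemma logmod_small p : sqmod p < 4^-1 -> `|logmod p| <= 1 /\ logmod p ^+ 2 <= 4 * sqmod p.
Proof.
move=> h; pose r := Num.sqrt (sqmod p).
have r0 : 0 <= r by exact: sqrtr_ge0.
have r2 : r ^+ 2 = sqmod p by rewrite sqr_sqrtr// sqmod_ge0.
have r1 : r < 2^-1.
  by rewrite -(ltr_pXn2r (isT : (0 < 2)%N)) ?nnegrE// r2 (lt_le_trans h)// exprVn; lra.
have [xl xu] : - r <= p.1 /\ p.1 <= r.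
  by move: r2; case: (p) => x y; rewrite /sqmod /=; split; nra.
have sl : (1 - r) ^+ 2 <= sqdist1 p.
  by move: r2 xl xu; case: (p) => x y; rewrite /sqmod /sqdist1 /=; nra.
have su : sqdist1 p <= (1 + r) ^+ 2.
  by move: r2 xl xu; case: (p) => x y; rewrite /sqmod /sqdist1 /=; nra.
have s0 : 0 < sqdist1 p by apply: lt_le_trans sl; nra.
have Lu : logmod p <= r.
  rewrite /logmod ler_pdivrMr//; apply: (le_trans (_ : _ <= ln ((1 + r) ^+ 2))).
    by rewrite ler_ln ?posrE//; nra.
  rewrite lnXn; last lra.
  have := @le_ln1Dx R r; rewrite mulr2n; lra.
have Ll : - (2 * r) <= logmod p.
  rewrite /logmod ler_pdivlMr//; apply: (@le_trans _ _ (ln ((1 - r) ^+ 2))); last first.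
    by rewrite ler_ln ?posrE//; nra.
  rewrite lnXn; last lra.
  have r1' : 0 < 1 - r by lra.
  suff : - (2 * r) <= ln (1 - r) by rewrite mulr2n; lra.
  apply: (le_trans _ (ln_ge1BV r1')).
  rewrite -subr_ge0 (_ : _ - _ = r * (1 - 2 * r) / (1 - r)); last by field; lra.
  by rewrite divr_ge0 ?mulr_ge0//; lra.
split; first by rewrite ler_norml; apply/andP; split; lra.
rewrite -r2; nra.
Qed.

(** Squared radius, to be compared with the squared distance [sqdist1]. The factor [1/8] leaves room
    for the [4^j] rotated copies of the disc to be disjoint; level 0 is [1/64]. *)
Definition dyadic_level (j : nat) : R := (4 ^- j / 8) ^+ 2.

(** Take the last level [j] whose disc contains the point. Then [sqdist1 p] exceeds level [j + 1],
    which is [2^-(4j+10)], so [|logmod p| / 2 <= (j + 5/2) ln 2]. Halving the logarithm keeps the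
    growth at [2^j], below the decay [4^-j] of the mass. *)
Lemma logmod_dyadic p : 0 < sqdist1 p -> sqdist1 p < 64^-1 ->
  exists j : nat, sqdist1 p <= dyadic_level j /\
    expR (`|logmod p| / 2) <= 2 ^+ (j + 3).
Proof.
move=> s0 s1; set s := sqdist1 p in s0 s1 *.
have lev_cvg : exists j, dyadic_level j.+1 < s.
  have [k ke] : exists k : nat, k.+1%:R^-1 < s.
    have [k _ ke] := near_infty_natSinv_lt (PosNum s0).
    by exists k; exact: ke (leqnn k).
  exists k; apply: le_lt_trans ke; rewrite /dyadic_level.
  have h4 : 0 < 4 ^- k.+1 :> R by rewrite invr_gt0 exprn_gt0.
  have h4' : 4 ^- k.+1 <= k.+1%:R^-1 :> R.
    rewrite lef_pV2 ?posrE ?exprn_gt0// -natrX ler_nat.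
    by rewrite (leq_trans (ltnW (ltn_expl _ (isT : (1 < 4)%N)))).
  have h1 : k.+1%:R^-1 <= 1 :> R by rewrite invf_le1 ?ler1n.
  move: h4 h4' h1; set a := _^-1; set b := _^-1 => a0 ab b1.
  have : a ^+ 2 <= a by rewrite expr2 ler_piMl//; lra.
  by rewrite expr_div_n; lra.
case: (ex_minnP lev_cvg) => j jP jmin; exists j.
have sj : s <= dyadic_level j.
  case: j jP jmin => [|j] jP jmin.
    by rewrite /dyadic_level expr0 (le_trans (ltW s1))// invr1; lra.
  by rewrite leNgt; apply/negP => /jmin; rewrite ltnn.
split=> //.
have lev0 : 0 < dyadic_level j.+1 by rewrite exprn_gt0// divr_gt0// invr_gt0 exprn_gt0.
have lnlev : ln (dyadic_level j.+1) = - (ln 2 * (4 * j%:R + 10)).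
  have -> : dyadic_level j.+1 = (2 ^+ (4 * j + 10))^-1.
    rewrite /dyadic_level (_ : 8 = 2 ^+ 3 :> R); last by rewrite -natrX.
    rewrite (_ : 4 = 2 ^+ 2 :> R); last by rewrite -natrX.
    rewrite -exprM -invfM -exprD exprVn -exprM; congr (_ ^+ _)^-1.
    by lia.
  by rewrite lnV ?posrE ?exprn_gt0// lnXn// -[ln 2 *+ _]mulr_natr natrD natrM.
have lns : ln s < 0 by rewrite ln_lt0// s0/=; lra.
have lns' : - (ln 2 * (4 * j%:R + 10)) <= ln s by rewrite -lnlev ler_ln ?posrE// ltW.
rewrite /logmod -/s ltr0_norm; last by rewrite pmulr_llt0// invr_gt0.
have -> : 2 ^+ (j + 3) = expR (ln 2 * (j%:R + 3)) :> R.
  rewrite -[in LHS](@lnK R 2) ?posrE// -expRM_natr; congr expR.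
  by rewrite -natrD.
rewrite ler_expR; have := ln2_ge; nra.
Qed.

Lemma logmod_pow_bound (m : nat) p : (2 <= m)%N -> sqmod p <= 1 ->
  `|logmod p| ^+ m <= (4 + 4 * 3 ^+ m) * sqmod p \/
  exists j : nat, [/\ 4^-1 <= sqmod p, sqdist1 p <= dyadic_level j &
    `|logmod p| ^+ m <= 2 ^+ m * m`!%:R * 2 ^+ (j + 3)].
Proof.
move=> m2 p1; have [psm|pbig] := ltP (sqmod p) 4^-1.
  left; have [L1 L2] := logmod_small psm.
  apply: (@le_trans _ _ (logmod p ^+ 2)).
    by rewrite -[leRHS]real_normK ?num_real// ler_wiXn2l.
  apply: (le_trans L2); rewrite ler_wpM2r ?sqmod_ge0// lerDl.
  by rewrite mulr_ge0// exprn_ge0.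
(* At [z = 1] the convention [ln 0 = 0] makes the left side 0. *)
have [s0|s0] := leP (sqdist1 p) 0.
  left; rewrite /logmod ln0// mul0r normr0 expr0n gtn_eqF ?(ltnW m2)//=.
  by rewrite mulr_ge0 ?sqmod_ge0// addr_ge0// mulr_ge0// exprn_ge0.
(* Away from 1 the logarithm is at most 3 in absolute value, and [3^m <= 4 * 3^m * sqmod p] because
   [sqmod p >= 1/4]. Closer to 1, [t^m / m! <= e^t] with [t = |logmod p| / 2] turns the exponential
   bound into one on powers. *)
have [sbig|ssm] := leP 64^-1 (sqdist1 p).
  left; have L3 : `|logmod p| <= 3.
    rewrite ler_norml /logmod ler_pdivlMr// ler_pdivrMr//; apply/andP; split.
      apply: (@le_trans _ _ (ln 64^-1)); last by rewrite ler_ln ?posrE ?invr_gt0.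
      rewrite lnV ?posrE// (_ : 64 = 2 ^+ 6); last by rewrite -natrX.
      by rewrite lnXn// -[ln 2 *+ _]mulr_natr; have := ln2_le1; lra.
    apply: (@le_trans _ _ (ln 4)); first by rewrite ler_ln ?posrE// sqdist1_le4.
    rewrite (_ : 4 = 2 ^+ 2); last by rewrite -natrX.
    by rewrite lnXn// -[ln 2 *+ _]mulr_natr; have := ln2_le1; lra.
  apply: (@le_trans _ _ (3 ^+ m)); first by rewrite lerXn2r ?nnegrE.
  have : 0 <= 3 ^+ m :> R by rewrite exprn_ge0.
  nra.
right; have [j [jE jL]] := logmod_dyadic s0 ssm; exists j; split => //.
case: m m2 => // m m2.
have h0 : 0 <= `|logmod p| / 2 by rewrite divr_ge0.
have := @expR_ge1Dxn R _ m h0.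
move: jL; set e := expR _; set t := _ ^+ _ / _ => jL te.
have {te} : t <= 2 ^+ (j + 3) by lra.
rewrite /t ler_pdivrMr ?ltr0n ?fact_gt0// expr_div_n ler_pdivrMr ?exprn_gt0//.
by move=> /le_trans; apply; rewrite le_eqVlt; apply/orP; left; apply/eqP; ring.
Qed.

(** With [A = |1 - z|^2], [B = |1 + z|^2] and [x >= 0], [ln B - ln A >= 1 - A / B = 4 x / B >= x]
    since [B <= 4]; and a sum of two squares is at least half the square of the difference. Negative
    [x] follows by exchanging [z] and [-z]. *)
Lemma logmod_sqr_lower p : sqmod p <= 1 ->
  p.1 ^+ 2 / 8 <= logmod p ^+ 2 + logmod (- p.1, - p.2) ^+ 2.
Proof.
have key x y : 0 <= x -> x ^+ 2 + y ^+ 2 <= 1 ->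
    x ^+ 2 / 8 <= logmod (x, y) ^+ 2 + logmod (- x, - y) ^+ 2.
  move=> x0 xy1; rewrite /logmod /sqdist1 /= sqrrN opprK.
  set A : R := (1 - x) ^+ 2 + _; set B := (1 + x) ^+ 2 + _.
  have B1 : 1 <= B by rewrite /B; nra.
  have B4 : B <= 4 by rewrite /B; nra.
  have A0 : 0 <= A by rewrite addr_ge0// sqr_ge0.
  (* Here [z = 1] and [ln A] is 0 by convention; the term of [-z], namely [(ln 2)^2 >= 1/4],
     suffices. *)
  have [A_0|A_0] := eqVneq A 0.
    have x1 : x = 1 by move: A_0; rewrite /A; nra.
    have y0 : y ^+ 2 = 0 by move: xy1; rewrite x1; nra.
    have -> : B = 2 ^+ 2 by rewrite /B x1 y0 addr0.
    rewrite lnXn// -[ln 2 *+ _]mulr_natr x1.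
    have l2 : 4^-1 <= ln 2 ^+ 2 :> R by have := ln2_ge; nra.
    rewrite expr1n mulfK//; apply: le_trans (lerD (sqr_ge0 _) l2); lra.
  have {A_0}A0 : 0 < A by rewrite lt_neqAle eq_sym A_0.
  have BA : x <= ln B - ln A.
    rewrite -ln_div ?posrE//; last lra.
    apply: le_trans (@ln_ge1BV (B / A) _); last by rewrite divr_gt0//; lra.
    rewrite invf_div -subr_ge0 (_ : _ - _ = (B - A - x * B) / B).
      by rewrite divr_ge0//; [rewrite /B /A in B4 *; nra|lra].
    by field; lra.
  have d2 : x ^+ 2 <= (ln B - ln A) ^+ 2 by rewrite lerXn2r ?nnegrE//; lra.
  have := sqr_ge0 (ln A + ln B); move: d2.
  by move: (ln A) (ln B) => a b; nra.
case: p => x y; rewrite /sqmod /= => h; have [x0|x0] := leP 0 x; first exact: key.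
have := @key (- x) (- y); rewrite !opprK [(- x) ^+ 2]sqrrN [(- y) ^+ 2]sqrrN => K.
by rewrite [leRHS]addrC; apply: K => //; rewrite oppr_ge0 ltW.
Qed.

Definition sqrpair p : R * R := (p.1 ^+ 2 - p.2 ^+ 2, 2 * p.1 * p.2).

Lemma logmod_sqrpair p : 0 < sqdist1 p -> 0 < sqdist1 (- p.1, - p.2) ->
  logmod p + logmod (- p.1, - p.2) = logmod (sqrpair p).
Proof.
move=> h1 h2; rewrite /logmod -mulrDl -lnM ?posrE//; congr (ln _ / 2).
by rewrite /sqdist1 /sqrpair /=; ring.
Qed.

End log_modulus.

(** * Rotation invariant laws on the unit disc *)

Section image_measure.
Context (R : realType) (d d' : measure_display).
Context (T : measurableType d) (T' : measurableType d').
Context (m : {measure set T -> \bar R}) (m' : {measure set T' -> \bar R}).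
Context (phi : T -> T') (mphi : measurable_fun setT phi).
Hypothesis mm' : forall A, measurable A -> m [set x | A (phi x)] = m' A.

(** The hypothesis [mm'] only compares values on measurable sets, so the same change of variables
    serves both for laws of random variables and for invariance, where [m] and [m'] coincide. *)
Lemma ge0_integral_image (f : T' -> \bar R) : measurable_fun setT f ->
  (forall y, (0 <= f y)%E) -> (\int[m]_x f (phi x) = \int[m']_y f y)%E.
Proof.
move=> mf f0; rewrite -(ge0_integral_pushforward mphi m measurableT)//.
by apply: eq_measure_integral => A mA _; exact: mm'.
Qed.

Lemma integrable_image (f : T' -> \bar R) : measurable_fun setT f ->
  m.-integrable setT (f \o phi) <-> m'.-integrable setT f.
Proof.
move=> mf.
have e : (\int[m]_x `|f (phi x)| = \int[m']_y `|f y|)%E.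
  by apply: (@ge0_integral_image (fun y => `|f y|%E)) => //; exact: measurableT_comp.
split=> /integrableP[_ h]; apply/integrableP; split => //.
- by rewrite -e.
- exact: measurableT_comp.
- by move: h; rewrite -e.
Qed.

Lemma integral_image (f : T' -> \bar R) : measurable_fun setT f ->
  m'.-integrable setT f -> (\int[m]_x f (phi x) = \int[m']_y f y)%E.
Proof.
move=> mf /integrable_image => /(_ mf) intf.
rewrite -(@integral_pushforward _ _ _ _ _ _ mphi m setT f)//.
by apply: eq_measure_integral => A mA _; exact: mm'.
Qed.

End image_measure.

Section rotation_invariance.
Context (R : realType).
Local Notation C := (R * R)%type.
Implicit Types (rho : probability C R) (p : C).

Definition rot (a b : R) p : C := (a * p.1 - b * p.2, b * p.1 + a * p.2).

Definition rotation_invariant rho : Prop :=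
  rho [set p | sqmod p <= 1] = 1%E /\
  forall a b, a ^+ 2 + b ^+ 2 = 1 -> forall A : set C, measurable A ->
    rho [set p | A (rot a b p)] = rho A.

Lemma measurable_rot a b : measurable_fun setT (rot a b : C -> C).
Proof.
apply: measurable_fun_pair => /=.
- by apply: measurable_funB; apply: measurable_funM => //.
- by apply: measurable_funD; apply: measurable_funM => //.
Qed.

Lemma measurable_sqrpair : measurable_fun setT (@sqrpair R : C -> C).
Proof.
apply: measurable_fun_pair => /=.
- by apply: measurable_funB; exact: measurable_funX.
- by apply: measurable_funM => //; exact: measurable_funM.
Qed.

Lemma measurable_sqmod : measurable_fun setT (@sqmod R : C -> R).
Proof. by apply: measurable_funD; exact: measurable_funX. Qed.

Lemma measurable_sqdist1 : measurable_fun setT (@sqdist1 R : C -> R).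
Proof.
apply: measurable_funD; apply: measurable_funX => //.
exact: measurable_funB.
Qed.

Lemma measurable_logmod : measurable_fun setT (@logmod R : C -> R).
Proof.
apply: measurable_funM => //.
exact: (measurableT_comp (@measurable_ln R) measurable_sqdist1).
Qed.

Lemma sqmod_rot a b p : a ^+ 2 + b ^+ 2 = 1 -> sqmod (rot a b p) = sqmod p.
Proof.
by move=> ab; rewrite /sqmod /rot /= -[RHS]mul1r -ab; ring.
Qed.

Lemma sqmod_sqrpair p : sqmod (sqrpair p) = sqmod p ^+ 2.
Proof. by rewrite /sqmod /sqrpair /=; ring. Qed.

Lemma measurable_unit_disc (r : R) : measurable [set p : C | sqmod p <= r].
Proof.
apply/measurable_bool_set/measurable_fun_ler; last exact: measurable_cst.
exact: measurable_sqmod.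
Qed.

Lemma ae_unit_disc rho : rotation_invariant rho -> {ae rho, forall p, sqmod p <= 1}.
Proof.
move=> [h _]; exists (~` [set p | sqmod p <= 1]); split => //.
  by apply: measurableC; exact: measurable_unit_disc.
by rewrite probability_setC ?h ?subee//; exact: measurable_unit_disc.
Qed.

(** Half-angle formulas; the sign of [b] decides that of [v]. A rotation of [z^2] by a unit number
    is thus the square of a rotation of [z], which makes the law of [z^2] rotation invariant. *)
Lemma unit_sqrt (a b : R) : a ^+ 2 + b ^+ 2 = 1 ->
  exists u v : R, [/\ u ^+ 2 + v ^+ 2 = 1, u ^+ 2 - v ^+ 2 = a & 2 * u * v = b].
Proof.
move=> ab.
have [a1 a1'] : -1 <= a /\ a <= 1 by split; nra.
have h1 : 0 <= (1 + a) / 2 by lra.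
have h2 : 0 <= (1 - a) / 2 by lra.
pose u := Num.sqrt ((1 + a) / 2); pose v := Num.sqrt ((1 - a) / 2).
have u2 : u ^+ 2 = (1 + a) / 2 by rewrite sqr_sqrtr.
have v2 : v ^+ 2 = (1 - a) / 2 by rewrite sqr_sqrtr.
have uv0 : 0 <= 2 * u * v by rewrite !mulr_ge0 ?sqrtr_ge0.
have uv2 : (2 * u * v) ^+ 2 = b ^+ 2.
  by rewrite !exprMn u2 v2; lra.
have [b0|b0] := leP 0 b.
  exists u, v; split; [lra|lra|].
  by apply/eqP; rewrite -(eqrXn2 (isT : (0 < 2)%N))// uv2.
exists u, (- v); rewrite sqrrN; split; [lra|lra|].
rewrite mulrN; apply: oppr_inj; rewrite opprK; apply/eqP.
rewrite -(eqrXn2 (isT : (0 < 2)%N)) ?sqrrN ?uv2//.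
by rewrite oppr_ge0 ltW.
Qed.

HB.instance Definition _ := isMeasurableFun.Build _ _ _ _ (@sqrpair R) measurable_sqrpair.

Lemma rotation_invariant_sqrpair rho : rotation_invariant rho ->
  rotation_invariant (distribution rho (@sqrpair R)).
Proof.
move=> [rho1 rhoV]; split.
  rewrite /distribution /= /pushforward -[RHS]rho1; congr (rho _).
  apply/seteqP; split => p /=; rewrite sqmod_sqrpair; have := sqmod_ge0 p; nra.
move=> a b ab A mA; have [u [v [uv <- <-]]] := unit_sqrt ab.
have mA' := measurable_preimage measurable_sqrpair mA.
apply: (etrans _ (rhoV u v uv _ mA')).
congr (rho _); rewrite /preimage; apply/seteqP; split => p /=; congr (A _);
  by rewrite /rot /sqrpair /=; congr pair; ring.
Qed.

End rotation_invariance.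

Section rotation_moments.
Context (R : realType).
Local Notation C := (R * R)%type.
Implicit Types (rho : probability C R) (p : C).

(** Its mass is at most [4 E |z|^2] by Markov. Bounding the mass near 1 by a fraction of this mass,
    rather than of 1, makes the final moment bounds proportional to [E |z|^2]. *)
Definition far_from0 : set C := [set p | 4^-1 <= sqmod p].

Definition near1 (j : nat) : set C :=
  far_from0 `&` [set p | sqdist1 p <= dyadic_level R j].

Lemma measurable_far_from0 : measurable far_from0.
Proof.
apply/measurable_bool_set/measurable_fun_ler; first exact: measurable_cst.
exact: measurable_sqmod.
Qed.

Lemma measurable_near1 j : measurable (near1 j).
Proof.
apply: measurableI; first exact: measurable_far_from0.
apply/measurable_bool_set/measurable_fun_ler; last exact: measurable_cst.
exact: measurable_sqdist1.
Qed.

(* The [4 ^ j] rotations by unit numbers of real part [l / 4 ^ j] carry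
   [near1 j] to disjoint sets. *)
Lemma near1_tail rho j : rotation_invariant rho ->
  (rho (near1 j) <= (4 ^- j)%:E * rho far_from0)%E.
Proof.
move=> [_ rhoV]; pose N := (4 ^ j)%N.
have N0 : 0 < N%:R :> R by rewrite ltr0n expn_gt0.
pose a (l : nat) : R := l%:R / N%:R.
pose b (l : nat) : R := Num.sqrt (1 - a l ^+ 2).
have ab l : (l < N)%N -> a l ^+ 2 + b l ^+ 2 = 1.
  move=> lN; have a1 : 0 <= a l <= 1.
    by rewrite divr_ge0//= ler_pdivrMr// mul1r ler_nat ltnW.
  rewrite sqr_sqrtr; first lra.
  by move: a1; move: (a l) => x /andP[]; nra.
pose F l := [set p | near1 j (rot (a l) (b l) p)].
have mF l : measurable (F l).
  by apply: (measurable_preimage (@measurable_rot _ _ _)); exact: measurable_near1.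
have tF : trivIset `I_N F.
  apply/trivIsetP => k l /= kN lN kl; rewrite -subset0 => p [/= [Fk1 Fk2] [_ Fl2]].
  have : 4^-1 <= sqmod p by rewrite -(sqmod_rot p (ab _ kN)).
  move: Fk2 Fl2; rewrite /dyadic_level /= -natrX -/N /sqdist1 /sqmod /rot /=.
  have akl : N%:R^-1 ^+ 2 <= (a k - a l) ^+ 2.
    rewrite /a -mulrBl exprMn ler_peMl ?sqr_ge0//.
    move: kl; case: ltngtP => // [kl|lk] _.
      have : k%:R + 1 <= l%:R :> R by rewrite natr1 ler_nat.
      by nra.
    have : l%:R + 1 <= k%:R :> R by rewrite natr1 ler_nat.
    by nra.
  set e := N%:R^-1 in akl *.
  have e0 : 0 < e by rewrite invr_gt0.
  move: akl; move: (a k) (a l) (b k) (b l) (p.1) (p.2) => ak al bk bl x y.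
  move=> akl Fk Fl xy4.
  (* The parallelogram inequality for the two rotated points [w_k z] and [w_l z], both close to 1.
     The right side is at most [e^2 / 16], while the left side is at least [e^2 / 4] because
     [|z|^2 >= 1/4]: a contradiction. *)
  have p1 : ((ak - al) ^+ 2 + (bk - bl) ^+ 2) * (x ^+ 2 + y ^+ 2) <=
      2 * ((1 - (ak * x - bk * y)) ^+ 2 + (bk * x + ak * y) ^+ 2) +
      2 * ((1 - (al * x - bl * y)) ^+ 2 + (bl * x + al * y) ^+ 2).
    rewrite -subr_ge0.
    set t := _ - _; have -> : t =
      ((1 - (ak * x - bk * y)) + (1 - (al * x - bl * y))) ^+ 2 +
      ((bk * x + ak * y) + (bl * x + al * y)) ^+ 2 by rewrite /t; ring.
    by rewrite addr_ge0// sqr_ge0.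
  have p2 : e ^+ 2 * 4^-1 <= ((ak - al) ^+ 2 + (bk - bl) ^+ 2) * (x ^+ 2 + y ^+ 2).
    by rewrite ler_pM ?sqr_ge0// (le_trans akl)// lerDl sqr_ge0.
  have e2 : 0 < e ^+ 2 by rewrite exprn_gt0.
  move: Fk Fl; rewrite expr_div_n; lra.
have -> : 4 ^- j = N%:R^-1 :> R by rewrite /N natrX.
rewrite muleC lee_pdivlMr// muleC.
have -> : (N%:R%:E * rho (near1 j) = \sum_(l < N) rho (F l))%E.
  rewrite (eq_bigr (fun=> rho (near1 j))) => [|l _].
    have n1fin : rho (near1 j) \is a fin_num.
      by apply: fin_num_measure; exact: measurable_near1.
    by rewrite -(fineK n1fin) sumEFin sumr_const card_ord -EFinM mulr_natl.
  by rewrite rhoV ?ab//; exact: measurable_near1.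
rewrite -(@measure_semi_additive_ord_I _ _ _ rho F N)//; last first.
  by apply: bigsetU_measurable => i _; exact: mF.
apply: le_measure; rewrite ?inE.
- by apply: bigsetU_measurable => i _; exact: mF.
- exact: measurable_far_from0.
- rewrite -bigcup_mkord => p [l /= lN [h _]].
  by rewrite /far_from0 /= -(sqmod_rot p (ab _ lN)).
Qed.

(** The first two terms bound the powers away from 1. In the last, [2^m m!] comes from
    [t^m / m! <= e^t], and [64 = 8 * 2 * 4] collects the factor [2^3] of the dyadic bound, the
    geometric series and Markov's inequality. *)
Definition logmod_moment_cst (m : nat) : R :=
  4 + 4 * 3 ^+ m + 64 * (2 ^+ m * m`!%:R).

Lemma nneseries_geometric_le (c : R) : 0 <= c ->
  (\sum_(0 <= j <oo) (c * 2 ^- j)%:E <= (2 * c)%:E)%E.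
Proof.
move=> c0; apply: lime_le.
  by apply: is_cvg_nneseries => j _ _; rewrite lee_fin mulr_ge0.
apply: nearW => n; rewrite sumEFin lee_fin.
suff -> : \sum_(0 <= j < n) c * 2 ^- j = 2 * c * (1 - 2 ^- n).
  by rewrite ler_piMr ?mulr_ge0// gerBl.
elim: n => [|n ih]; first by rewrite big_geq// expr0 invr1 subrr mulr0.
rewrite big_nat_recr//= ih exprS invfM; set q := _^-1; by field.
Qed.

(** The level [j] depends on the point, so the pointwise bound is replaced by the series of all
    [2^(j+3)] times indicators of [near1 j], of which one term suffices. By [near1_tail] its
    integral is dominated by a geometric series of ratio [1/2]. *)
Lemma integral_abs_logmod_pow rho (m : nat) : rotation_invariant rho -> (2 <= m)%N ->
  (\int[rho]_p (`|logmod p| ^+ m)%:E <=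
   (logmod_moment_cst m)%:E * \int[rho]_p (sqmod p)%:E)%E.
Proof.
move=> ri m2; have mL := @measurable_logmod R; have mS := @measurable_sqmod R.
pose c1 : R := 4 + 4 * 3 ^+ m; pose c2 : R := 2 ^+ m * m`!%:R.
have c10 : 0 <= c1 by rewrite addr_ge0// mulr_ge0// exprn_ge0.
have c20 : 0 <= c2 by rewrite mulr_ge0// exprn_ge0.
pose g j p : \bar R := (c2 * 2 ^+ (j + 3) * \1_(near1 j) p)%:E.
have g0 j p : (0 <= g j p)%E by rewrite lee_fin !mulr_ge0// exprn_ge0.
have mg j : measurable_fun setT (g j).
  by apply/measurable_EFinP/measurable_funM => //; apply: measurable_indic; exact: measurable_near1.
have mser : measurable_fun setT (fun p => \sum_(0 <= j <oo) g j p)%E.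
  exact: ge0_emeasurable_sum.
have le_ae : (\int[rho]_p (`|logmod p| ^+ m)%:E <=
    \int[rho]_p ((c1 * sqmod p)%:E + \sum_(0 <= j <oo) g j p))%E.
  apply: ae_ge0_le_integral; first exact: measurableT.
  - by move=> p _; rewrite lee_fin exprn_ge0.
  - by apply/measurable_EFinP/measurable_funX; exact: measurableT_comp.
  - by move=> p _; rewrite adde_ge0 ?nneseries_ge0// lee_fin mulr_ge0 ?sqmod_ge0.
  - by apply: emeasurable_funD => //; apply/measurable_EFinP/measurable_funM.
  apply: filterS (ae_unit_disc ri) => p p1 _.
  have [h|[j [h1 h2 h3]]] := logmod_pow_bound m2 p1.
    by rewrite -[leLHS]adde0 leeD ?lee_fin// nneseries_ge0.
  rewrite -[leLHS]add0e leeD ?lee_fin ?mulr_ge0 ?sqmod_ge0//.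
  apply: (le_trans _ (nneseries_lim_ge j.+1 _)) => //.
  rewrite big_nat_recr//= -[leLHS]add0e leeD ?sume_ge0//.
  by rewrite /g indicE mem_set ?mulr1// lee_fin.
apply: (le_trans le_ae).
rewrite ge0_integralD//; last 3 first.
- by move=> p _; rewrite lee_fin mulr_ge0 ?sqmod_ge0.
- exact/measurable_EFinP/measurable_funM.
- by move=> p _; exact: nneseries_ge0.
have farS : (rho far_from0 <= 4%:E * \int[rho]_p (sqmod p)%:E)%E.
  rewrite -ge0_integralZl//; last 2 first.
  - exact/measurable_EFinP.
  - by move=> p _; rewrite lee_fin sqmod_ge0.
  rewrite -[leLHS](_ : \int[rho]_p (\1_far_from0 p)%:E = _)%E; last first.
    by rewrite integral_indic ?setIT//; exact: measurable_far_from0.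
  apply: ge0_le_integral => //.
  - by apply/measurable_EFinP; apply: measurable_indic; exact: measurable_far_from0.
  - by apply/measurable_EFinP/measurable_funM.
  move=> p _; rewrite -EFinM lee_fin indicE; case: (boolP (p \in _)) => [|_].
    by rewrite inE /far_from0 /=; lra.
  by rewrite mulr_ge0// sqmod_ge0.
rewrite integral_nneseries//.
have serS : (\sum_(0 <= j <oo) \int[rho]_p g j p <=
    (16 * c2)%:E * rho far_from0)%E.
  have far_fin : rho far_from0 \is a fin_num.
    by apply: fin_num_measure; exact: measurable_far_from0.
  rewrite -(fineK far_fin) -EFinM; set B := fine _.
  have B0 : 0 <= B by rewrite fine_ge0.
  rewrite (_ : 16 * c2 * B = 2 * (8 * c2 * B)); last by ring.
  apply: (le_trans _ (nneseries_geometric_le _)); last by rewrite !mulr_ge0.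
  apply: lee_nneseries => [j _ _|j _]; first exact: integral_ge0.
  rewrite /g; under eq_integral do rewrite EFinM.
  rewrite ge0_integralZl//; last 2 first.
  - by apply/measurable_EFinP; apply: measurable_indic; exact: measurable_near1.
  - by rewrite lee_fin mulr_ge0// exprn_ge0.
  rewrite integral_indic ?setIT//; last exact: measurable_near1.
  apply: (@le_trans _ _ ((c2 * 2 ^+ (j + 3))%:E * ((4 ^- j)%:E * rho far_from0))%E).
    by rewrite lee_wpmul2l ?near1_tail// lee_fin mulr_ge0// exprn_ge0.
  rewrite -(fineK far_fin) -/B -!EFinM lee_fin le_eqVlt; apply/orP; left; apply/eqP.
  rewrite (_ : 4 = 2 ^+ 2 :> R); last by rewrite -natrX.
  rewrite -exprM mul2n -addnn !exprD; field.
  by rewrite expf_neq0.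
under eq_integral do rewrite EFinM.
rewrite ge0_integralZl//; last 2 first.
- exact/measurable_EFinP.
- by move=> p _; rewrite lee_fin sqmod_ge0.
apply: (@le_trans _ _ (c1%:E * \int[rho]_p (sqmod p)%:E +
    (16 * c2)%:E * (4%:E * \int[rho]_p (sqmod p)%:E))%E).
  rewrite leeD2l//; apply: (le_trans serS); rewrite lee_wpmul2l//.
  by rewrite lee_fin mulr_ge0.
rewrite muleA -EFinM -ge0_muleDl ?lee_fin ?mulr_ge0//.
rewrite -EFinD (_ : logmod_moment_cst m = c1 + 16 * c2 * 4)//.
by rewrite /logmod_moment_cst /c1 /c2; ring.
Qed.
End rotation_moments.

Section rotation_mean_variance.
Context (R : realType).
Local Notation C := (R * R)%type.
Implicit Types (rho : probability C R) (p : C).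

Lemma logmod_moment_cst_ge0 m : 0 <= logmod_moment_cst R m.
Proof. by rewrite !addr_ge0// !mulr_ge0// ?exprn_ge0// mulr_ge0// exprn_ge0. Qed.

Lemma integral_sqmod_le1 rho : rotation_invariant rho ->
  (\int[rho]_p (sqmod p)%:E <= 1)%E.
Proof.
move=> ri; have mS := @measurable_sqmod R.
have -> : 1%E = (\int[rho]_p (cst 1%:E p))%E.
  by rewrite integral_cst// mul1e; exact/esym/probability_setT.
apply: ae_ge0_le_integral; first exact: measurableT.
- by move=> p _; rewrite lee_fin sqmod_ge0.
- exact/measurable_EFinP.
- by move=> p _; rewrite lee_fin.
- exact: measurable_cst.
- by apply: filterS (ae_unit_disc ri) => p p1 _; rewrite lee_fin.
Qed.

Lemma integrable_sqmod rho : rotation_invariant rho ->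
  rho.-integrable setT (fun p => (sqmod p)%:E).
Proof.
move=> ri; have mS := @measurable_sqmod R.
apply/integrableP; split; first exact/measurable_EFinP.
under eq_integral do rewrite gee0_abs ?lee_fin ?sqmod_ge0//.
by rewrite (le_lt_trans (integral_sqmod_le1 ri))// ltry.
Qed.

Lemma integrable_logmod_pow rho (m : nat) : rotation_invariant rho ->
  rho.-integrable setT (fun p => (logmod p ^+ m)%:E).
Proof.
move=> ri; have mL := @measurable_logmod R.
have mLk k : measurable_fun setT (fun p : C => (logmod p ^+ k)%:E).
  exact/measurable_EFinP/measurable_funX.
have ge2 k : (2 <= k)%N -> rho.-integrable setT (fun p => (logmod p ^+ k)%:E).
  move=> k2; apply/integrableP; split => //.
  under eq_integral do rewrite abse_EFin normrX.
  apply: (le_lt_trans (integral_abs_logmod_pow ri k2)).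
  have Kk := logmod_moment_cst_ge0 k.
  apply: (@le_lt_trans _ _ ((logmod_moment_cst R k)%:E * 1)%E); last by rewrite mule1 ltry.
  by rewrite lee_wpmul2l// integral_sqmod_le1.
have i0 : rho.-integrable setT (cst 1%:E : C -> \bar R).
  by apply: finite_measure_integrable_cst.
case: m => [|[|m]]; [|  |exact: ge2].
  by apply: eq_integrable i0 => // p _; rewrite expr0.
(* The moment bound starts at order 2; order 1 follows from [|x| <= 1 + x^2]. *)
apply: (@le_integrable _ _ _ rho setT measurableT _ (fun p => (1 + logmod p ^+ 2)%:E)) => //.
  move=> p _; rewrite !abse_EFin lee_fin expr1 [leRHS]ger0_norm; last by rewrite addr_ge0// sqr_ge0.
  by rewrite ler_norml; apply/andP; split; nra.
by apply: (integrableD measurableT i0 (ge2 2%N _)).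
Qed.

Lemma normr_integral_logmod_pow rho (m : nat) : rotation_invariant rho ->
  (2 <= m)%N ->
  `|\int[rho]_p (logmod p ^+ m)| <=
    logmod_moment_cst R m * \int[rho]_p (sqmod p).
Proof.
move=> ri m2; have iL := integrable_logmod_pow m ri.
rewrite -lee_fin EFinM /Rintegral fineK; last exact: integrable_fin_num (integrable_sqmod ri).
apply: le_trans (integral_abs_logmod_pow ri m2).
have := le_abse_integral rho measurableT (measurable_int _ iL).
rewrite -abse_EFin fineK; last exact: integrable_fin_num iL.
move=> /le_trans; apply; rewrite le_eqVlt; apply/orP; left; apply/eqP.
by apply: eq_integral => p _; rewrite abse_EFin normrX.
Qed.

Lemma measurable_sqdist1_eq0 : measurable [set p : C | sqdist1 p = 0].
Proof.
rewrite (_ : mkset _ = [set p | sqdist1 p == 0]); last first.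
  by apply/seteqP; split => p /eqP.
apply/measurable_bool_set/measurable_fun_eqr; last exact: measurable_cst.
exact: measurable_sqdist1.
Qed.

(** The point 1 lies in every [near1 j], of mass at most [4^-j]. *)
Lemma sqdist1_eq0_null rho : rotation_invariant rho ->
  rho [set p | sqdist1 p = 0] = 0%E.
Proof.
move=> ri.
have m0 := measurable_sqdist1_eq0.
have sub j : [set p : C | sqdist1 p = 0] `<=` @near1 R j.
  move=> [x y] /= h; have h' : (1 - x) ^+ 2 + y ^+ 2 = 0 by [].
  split => /=; last by rewrite h exprn_ge0// divr_ge0// invr_ge0 exprn_ge0.
  by rewrite /far_from0 /sqmod /=; nra.
have le (j : nat) : (rho [set p : C | sqdist1 p = 0%R] <= (j.+1%:R^-1)%:E)%E.
  apply: (@le_trans _ _ (rho (@near1 R j.+1))).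
    by apply: le_measure => //; rewrite inE//; exact: measurable_near1.
  apply: (le_trans (near1_tail _ ri)).
  rewrite -[leRHS]mule1; apply: lee_pmul => //.
  - rewrite lee_fin lef_pV2 ?posrE ?exprn_gt0// -natrX ler_nat.
    exact/ltnW/ltn_expl.
  - by apply: probability_le1; exact: measurable_far_from0.
apply/eqP; rewrite eq_le measure_ge0 andbT.
apply/lee_addgt0Pr => e e0; rewrite add0e.
have [k _ ke] := near_infty_natSinv_lt (PosNum e0).
by apply: (le_trans (le k)); rewrite lee_fin ltW//; exact: ke (leqnn k).
Qed.

Lemma integral_rot rho (a b : R) (f : C -> R) : rotation_invariant rho ->
  a ^+ 2 + b ^+ 2 = 1 -> measurable_fun setT f ->
  rho.-integrable setT (EFin \o f) ->
  rho.-integrable setT (fun p => (f (rot a b p))%:E) /\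
  \int[rho]_p (f (rot a b p)) = \int[rho]_p (f p).
Proof.
move=> [_ rhoV] ab mf intf.
have mf' : measurable_fun setT (EFin \o f) by exact/measurable_EFinP.
have h A (mA : measurable A) := rhoV _ _ ab A mA.
split; first exact/(integrable_image (measurable_rot a b) h mf').
by rewrite /Rintegral -(integral_image (measurable_rot a b) h mf' intf).
Qed.

(* [log |1 - z| + log |1 + z| = log |1 - z ^ 2|], and [z ^ 2] is again
   rotation invariant: the mean is halved at each squaring. *)
Lemma integral_logmod0 rho : rotation_invariant rho ->
  \int[rho]_p (logmod p) = 0.
Proof.
(* Each squaring changes the law, so the halving argument needs a bound on the mean that is uniform
   over all rotation invariant laws. *)
pose K : R := 1 + logmod_moment_cst R 2.
have K1 : 0 <= K by rewrite addr_ge0// logmod_moment_cst_ge0.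
have bnd rho' : rotation_invariant rho' -> `|\int[rho']_p (logmod p)| <= K.
  move=> ri.
  have i1 : rho'.-integrable setT (EFin \o @logmod R).
    by apply: eq_integrable (integrable_logmod_pow 1 ri) => // p _; rewrite expr1.
  have i2 := integrable_logmod_pow 2 ri.
  have i0 : rho'.-integrable setT (cst 1%:E : C -> \bar R).
    by apply: finite_measure_integrable_cst.
  apply: (le_trans (le_normr_Rintegral measurableT i1)).
  apply: (@le_trans _ _ (\int[rho']_p (1 + logmod p ^+ 2))).
    apply: le_Rintegral => //.
    - exact: integrable_norm i1.
    - exact: (integrableD measurableT i0 i2).
    - by move=> p _; rewrite ler_norml; apply/andP; split; nra.
  have c1 : \int[rho']_p (1 : R) = 1.
    by rewrite Rintegral_cst// mul1r; exact: (congr1 fine (probability_setT rho')).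
  rewrite RintegralD// c1 lerD2l.
  have := normr_integral_logmod_pow ri (leqnn 2).
  move=> /(le_trans (ler_norm _)) /le_trans; apply.
  rewrite ler_piMr//; first exact: logmod_moment_cst_ge0.
  rewrite -lee_fin fineK ?integral_sqmod_le1//.
  exact: integrable_fin_num (integrable_sqmod ri).
have half rho' : rotation_invariant rho' ->
    \int[rho']_p (logmod p) =
    \int[distribution rho' (@sqrpair R)]_p (logmod p) / 2.
  move=> ri; have ri2 := rotation_invariant_sqrpair ri.
  have i1 rho2 : rotation_invariant rho2 -> rho2.-integrable setT (EFin \o @logmod R).
    by move=> ri'; apply: eq_integrable (integrable_logmod_pow 1 ri') => // p _; rewrite expr1.
  have mLE : measurable_fun setT (EFin \o @logmod R).
    by apply/measurable_EFinP; exact: measurable_logmod.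
  have m1 : (-1) ^+ 2 + 0 ^+ 2 = 1 :> R by rewrite sqrrN expr1n expr0n addr0.
  have [i1' eN] := integral_rot ri m1 (@measurable_logmod R) (i1 _ ri).
  have hd A (mA : measurable A) : rho' [set x | A (sqrpair x)] = distribution rho' (@sqrpair R) A by [].
  have is_ : rho'.-integrable setT (fun p => (logmod (sqrpair p))%:E).
    exact/(integrable_image (@measurable_sqrpair R) hd mLE)/i1.
  have -> : \int[distribution rho' (@sqrpair R)]_p (logmod p) = \int[rho']_p (logmod (sqrpair p)).
    by rewrite /Rintegral -(integral_image (@measurable_sqrpair R) hd mLE (i1 _ ri2)).
  (* Because [ln 0 = 0], the identity is used only off [z = 1] and [z = -1], which are null. *)
  have -> : \int[rho']_p (logmod (sqrpair p)) = \int[rho']_p (logmod p + logmod (rot (-1) 0 p)).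
    congr fine; apply: ae_eq_integral => //; first exact: measurable_int is_.
      by apply: measurable_int (integrableD measurableT (i1 _ ri) i1').
    have rE (p : C) : rot (-1) 0 p = (- p.1, - p.2).
      by rewrite /rot; congr pair; ring.
    have a1 : {ae rho', forall p, sqdist1 p <> 0}.
      exists [set p | sqdist1 p = 0]; split.
      - exact: measurable_sqdist1_eq0.
      - exact: sqdist1_eq0_null.
      - by move=> p /= /contrapT.
    have a2 : {ae rho', forall p, sqdist1 (rot (-1) 0 p) <> 0}.
      exists [set p | sqdist1 (rot (-1) 0 p) = 0]; split.
      - exact: (measurable_preimage (measurable_rot (-1) 0) measurable_sqdist1_eq0).
      - by case: (ri) => _ /(_ _ _ m1 _ measurable_sqdist1_eq0) ->; exact: sqdist1_eq0_null.
      - by move=> p /= /contrapT.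
    apply: filterS2 a1 a2 => p; rewrite rE => /eqP h1 /eqP h2 _.
    by rewrite logmod_sqrpair// lt_neqAle eq_sym ?h1 ?h2 sqdist1_ge0.
  rewrite RintegralD//; last exact: i1.
  by rewrite eN; field.
move=> ri; apply/eqP; rewrite -normr_le0.
have it k : forall rho', rotation_invariant rho' ->
    `|\int[rho']_p (logmod p)| <= K / 2 ^+ k.
  elim: k => [|k ih] rho' ri'; first by rewrite expr0 divr1 bnd.
  rewrite half// normrM [`|2^-1|]ger0_norm//.
  have := ih _ (rotation_invariant_sqrpair ri').
  by rewrite exprS invfM mulrCA [K / _ in X in X -> _]mulrC; lra.
apply/ler_addgt0Pr => e e0; rewrite add0r.
have [k _ ke] := near_infty_natSinv_lt (PosNum (divr_gt0 e0 (ltr_wpDl K1 (ltr01)))).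
apply: (le_trans (it k.+1 _ ri)).
have := ke k (leqnn k) => /= {}ke.
have h2 : 2 ^- k.+1 <= k.+1%:R^-1 :> R.
  by rewrite lef_pV2 ?posrE ?exprn_gt0// -natrX ler_nat ltnW// ltn_expl.
have K0 : 0 < K + 1 by lra.
move: ke; rewrite ltr_pdivlMr// => ke.
have := le_trans (ler_wpM2l K1 h2) (_ : K * k.+1%:R^-1 <= e); apply.
apply: le_trans (ltW ke); rewrite mulrC ler_wpM2l//; lra.
Qed.

(** Average over the rotations by [1, -1, i, -i]: the pair [z, -z] yields [x^2 / 8] and the pair
    [iz, -iz] yields [y^2 / 8]. Four equal integrals thus dominate [E |z|^2 / 8], whence [32]. *)
Lemma integral_logmod_sqr_lower rho : rotation_invariant rho ->
  \int[rho]_p (sqmod p) / 32 <= \int[rho]_p (logmod p ^+ 2).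
Proof.
move=> ri; have iL := integrable_logmod_pow 2 ri.
have mL2 : measurable_fun setT (fun p : C => logmod p ^+ 2).
  by apply: measurable_funX; exact: measurable_logmod.
have m1 : (-1) ^+ 2 + 0 ^+ 2 = 1 :> R by rewrite sqrrN expr1n expr0n addr0.
have m2 : 0 ^+ 2 + 1 ^+ 2 = 1 :> R by rewrite expr1n expr0n add0r.
have m3 : 0 ^+ 2 + (-1) ^+ 2 = 1 :> R by rewrite sqrrN expr1n expr0n add0r.
have [i1 e1] := integral_rot ri m1 mL2 iL.
have [i2 e2] := integral_rot ri m2 mL2 iL.
have [i3 e3] := integral_rot ri m3 mL2 iL.
have S : \int[rho]_p ((logmod p ^+ 2 + logmod (rot (-1) 0 p) ^+ 2) +
    (logmod (rot 0 1 p) ^+ 2 + logmod (rot 0 (-1) p) ^+ 2)) =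
    4 * \int[rho]_p (logmod p ^+ 2).
  rewrite RintegralD//; last 2 first.
  - exact: (integrableD measurableT iL i1).
  - exact: (integrableD measurableT i2 i3).
  by rewrite !RintegralD// e1 e2 e3; ring.
suff : \int[rho]_p (8^-1 * sqmod p) <= 4 * \int[rho]_p (logmod p ^+ 2).
  by rewrite RintegralZl//; [lra|exact: integrable_sqmod].
have i8 : rho.-integrable setT (fun p => (8^-1 * sqmod p)%:E).
  by under eq_fun do rewrite EFinM; exact: integrableZl (integrable_sqmod ri).
have iS : rho.-integrable setT (fun p =>
    ((logmod p ^+ 2 + logmod (rot (-1) 0 p) ^+ 2) +
    (logmod (rot 0 1 p) ^+ 2 + logmod (rot 0 (-1) p) ^+ 2))%:E).
  exact: (integrableD measurableT (integrableD measurableT iL i1) (integrableD measurableT i2 i3)).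
rewrite -S -lee_fin /Rintegral !fineK; last 2 first.
- exact: integrable_fin_num iS.
- exact: integrable_fin_num i8.
apply: ae_ge0_le_integral; first exact: measurableT.
- by move=> p _; rewrite lee_fin mulr_ge0// sqmod_ge0.
- exact: measurable_int i8.
- by move=> p _; rewrite lee_fin !addr_ge0// sqr_ge0.
- exact: measurable_int iS.
apply: filterS (ae_unit_disc ri) => p p1 _; rewrite lee_fin.
have := logmod_sqr_lower p1.
have p1' : sqmod (rot 0 1 p) <= 1 by rewrite sqmod_rot.
have := logmod_sqr_lower p1'.
have -> : (- p.1, - p.2) = rot (-1) 0 p by rewrite /rot; congr pair; ring.
have -> : (- (rot 0 1 p).1, - (rot 0 1 p).2) = rot 0 (-1) p.
  by rewrite /rot /=; congr pair; ring.
rewrite /sqmod [(rot 0 1 p).1]/= mul0r mul1r sub0r sqrrN.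
lra.
Qed.

End rotation_mean_variance.

(** * Moments of the logarithm of the characteristic polynomial *)

Section independent_moments.
Context (R : realType) (d : measure_display) (T : measurableType d).
Context (P : probability T R) (X Y : T -> R).
Hypothesis mX : measurable_fun setT X.
Hypothesis mY : measurable_fun setT Y.
Hypothesis XY : forall A B : set R, measurable A -> measurable B ->
  P ([set w | A (X w)] `&` [set w | B (Y w)]) =
  (P [set w | A (X w)] * P [set w | B (Y w)])%E.

HB.instance Definition _ := isMeasurableFun.Build _ _ _ _ X mX.
HB.instance Definition _ := isMeasurableFun.Build _ _ _ _ Y mY.

Let PX := distribution P X.
Let PY := distribution P Y.
Let XYp (w : T) : R * R := (X w, Y w).

Let mXY : measurable_fun setT XYp. Proof. exact: measurable_fun_pair. Qed.

Let PXY (A : set (R * R)) : measurable A -> P [set w | A (XYp w)] = (PX \x PY)%E A.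
Proof.
move=> mA; apply/esym.
by apply: (@product_measure_unique _ _ _ _ R PX PY (pushforward P XYp)).
Qed.

Lemma independent_integralM (f g : R -> R) :
  measurable_fun setT f -> measurable_fun setT g ->
  P.-integrable setT (fun w => (f (X w))%:E) ->
  P.-integrable setT (fun w => (g (Y w))%:E) ->
  P.-integrable setT (fun w => (f (X w) * g (Y w))%:E) /\
  \int[P]_w (f (X w) * g (Y w)) = \int[P]_w (f (X w)) * \int[P]_w (g (Y w)).
Proof.
move=> mf mg iX iY.
have mfE : measurable_fun setT (EFin \o f) by exact/measurable_EFinP.
have mgE : measurable_fun setT (EFin \o g) by exact/measurable_EFinP.
have hX A (mA : measurable A) : P [set x | A (X x)] = PX A by [].
have hY A (mA : measurable A) : P [set x | A (Y x)] = PY A by [].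
have iPX : PX.-integrable setT (EFin \o f) by exact/(integrable_image mX hX mfE).
have iPY : PY.-integrable setT (EFin \o g) by exact/(integrable_image mY hY mgE).
pose h (z : R * R) : \bar R := (f z.1 * g z.2)%:E.
have mh : measurable_fun setT h.
  apply/measurable_EFinP/measurable_funM.
  - exact: (measurableT_comp mf measurable_fst).
  - exact: (measurableT_comp mg measurable_snd).
have ih : (PX \x PY)%E.-integrable setT h.
  apply/integrable12ltyP => //.
  have -> : (\int[PX]_x \int[PY]_y `|h (x, y)| =
      (\int[PX]_x `|(f x)%:E|) * (\int[PY]_y `|(g y)%:E|))%E.
    rewrite -ge0_integralZr//; last 2 first.
    - exact: measurableT_comp.
    - exact: integral_ge0.
    apply: eq_integral => x _; rewrite -ge0_integralZl//; last first.
      exact: measurableT_comp.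
    by apply: eq_integral => y _; rewrite -abseM -EFinM.
  move/integrableP : iPX => [_ iPX]; move/integrableP : iPY => [_ iPY].
  apply: lte_mul_pinfty => //; first exact: integral_ge0.
  by rewrite ge0_fin_numE ?integral_ge0.
have eXY : (\int[P]_w h (XYp w) = \int[(PX \x PY)%E]_z h z)%E.
  exact: (integral_image mXY PXY mh ih).
split; first exact/(integrable_image mXY PXY mh).
have fX : (\int[P]_w (f (X w))%:E)%E = (\int[PX]_x (f x)%:E)%E.
  exact: (integral_image mX hX mfE iPX).
have fY : (\int[P]_w (g (Y w))%:E)%E = (\int[PY]_x (g x)%:E)%E.
  exact: (integral_image mY hY mgE iPY).
rewrite /Rintegral fX fY -fineM; last 2 first.
- exact: integrable_fin_num iPX.
- exact: integrable_fin_num iPY.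
congr fine; rewrite eXY -(integral12_prod_meas1 ih) /fubini_F.
rewrite -(fineK (integrable_fin_num measurableT iPY)) -integralZr//.
apply: eq_integral => x _; rewrite /h /=.
under eq_integral do rewrite EFinM.
by rewrite integralZl// (fineK (integrable_fin_num measurableT iPY)).
Qed.

Lemma independent_moment_add (k : nat) :
  (forall i, P.-integrable setT (fun w => (X w ^+ i)%:E)) ->
  (forall i, P.-integrable setT (fun w => (Y w ^+ i)%:E)) ->
  P.-integrable setT (fun w => ((X w + Y w) ^+ k)%:E) /\
  \int[P]_w ((X w + Y w) ^+ k) =
  \sum_(i < k.+1) 'C(k, i)%:R * \int[P]_w (X w ^+ (k - i)) * \int[P]_w (Y w ^+ i).
Proof.
move=> iX iY.
have h i := @independent_integralM (fun x => x ^+ (k - i)) (fun x => x ^+ i)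
  (exprn_measurable _) (exprn_measurable _) (iX (k - i)%N) (iY i).
have hk (i : nat) : P.-integrable setT
    (fun w => ('C(k, i)%:R * (X w ^+ (k - i) * Y w ^+ i))%:E).
  under eq_fun do rewrite EFinM.
  by apply: integrableZl => //; exact: (h i).1.
have E w : ((X w + Y w) ^+ k)%:E =
    (\sum_(i < k.+1) ('C(k, i)%:R * (X w ^+ (k - i) * Y w ^+ i))%:E)%E.
  rewrite exprDn sumEFin; congr EFin; apply: eq_bigr => i _.
  by rewrite mulr_natl.
split.
  under eq_fun do rewrite E.
  by apply: integrable_sum => // i _; exact: hk.
rewrite /Rintegral; under eq_integral do rewrite E.
rewrite integral_sum//.
rewrite -sum_fine => [|i _]; last exact: integrable_fin_num (hk i).
apply: eq_bigr => i _; rewrite -mulrA -(h i).2.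
by rewrite -/(Rintegral _ _ _) RintegralZl//; exact: (h i).1.
Qed.

End independent_moments.

(** * Law of the upper left entry *)

Section corner_law.
Context (R : realType) (n : nat).
Local Notation X := (mxborel R n.+1).
Context (mu : probability X R) (muinv : left_invariant mu).

Definition re_im (z : cplx R) : R * R := (complex.Re z, complex.Im z).

Definition corner (M : X) : R * R := re_im ((M : 'M[cplx R]_n.+1) 0 0).

Lemma measurable_corner : measurable_fun setT corner.
Proof.
apply: measurable_fun_pair.
- exact: measurable_Re_coord.
- exact: measurable_Im_coord.
Qed.

HB.instance Definition _ := isMeasurableFun.Build _ _ _ _ corner measurable_corner.

Definition corner_law : probability (R * R)%type R := distribution mu corner.

Lemma mul_conj_sqmod (z : cplx R) : z * Num.conj z = ((sqmod (re_im z))%:C)%C.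
Proof.
case: z => a b; rewrite /sqmod /=; apply/eqP; rewrite eq_complex /=.
by apply/andP; split; apply/eqP; ring.
Qed.

Lemma sum_sqmod_row (M : 'M[cplx R]_n.+1) (i : 'I_n.+1) : M \is unitarymx ->
  \sum_j sqmod (re_im (M i j)) = 1.
Proof.
move=> /unitarymxP /matrixP /(_ i i); rewrite !mxE eqxx mulr1n => h.
have : \sum_j ((sqmod (re_im (M i j)))%:C)%C = 1 :> cplx R.
  by rewrite -h; apply: eq_bigr => j _; rewrite !mxE -mul_conj_sqmod.
by rewrite -(raddf_sum (real_complex R)) => /(congr1 (@complex.Re R)).
Qed.

(** A unit scalar matrix is unitary, and multiplying by it rotates the corner. The law sits on the
    disc because rows of a unitary matrix have norm 1. *)
Lemma corner_rotation_invariant : rotation_invariant corner_law.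
Proof.
case: muinv => mu0 muV; split.
  have mU := @measurable_unitary_group R n.+1.
  have mD := measurable_preimage measurable_corner (@measurable_unit_disc R 1).
  have mu1 : mu (unitary_group R n.+1) = 1%E.
    by rewrite -[unitary_group R n.+1]setCK probability_setC ?mu0 ?sube0//; exact: measurableC.
  apply/eqP; rewrite eq_le; apply/andP; split.
    by apply: probability_le1; exact: measurable_unit_disc.
  rewrite -mu1; apply: le_measure; rewrite ?inE//.
  move=> M /= /(sum_sqmod_row 0); rewrite (bigD1 0)//= => <-.
  by rewrite lerDl sumr_ge0// => j _; exact: sqmod_ge0.
move=> a b ab A mA; pose w : cplx R := (a +i* b)%C.
have wU : (w%:M : 'M[cplx R]_n.+1) \is unitarymx.
  apply/unitarymxP; rewrite tr_scalar_mx map_scalar_mx /= -scalar_mxM mul_conj_sqmod.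
  by rewrite /sqmod /= ab.
have mA' := measurable_preimage measurable_corner mA.
apply: (etrans _ (muV _ _ wU mA')); congr (mu _).
have e (M : X) : corner (w%:M *m (M : 'M[cplx R]_n.+1)) = rot a b (corner M).
  rewrite /corner mul_scalar_mx mxE /rot /re_im /=.
  by case: (fun_of_matrix _ 0 0) => x y /=; congr pair; ring.
by apply/seteqP; split => M /=; rewrite e.
Qed.

(** Row transpositions are left multiplications, so the [n + 1] entries of the first column have
    equal mean squares, and these sum to 1. *)
Lemma corner_sqmod_mean : \int[corner_law]_p (sqmod p) = n.+1%:R^-1.
Proof.
case: (muinv) => mu0 muV.
pose f (i : 'I_n.+1) (M : X) : R := sqmod (re_im ((M : 'M[cplx R]_n.+1) i 0)).
have mf i : measurable_fun setT (f i).
  apply: (measurableT_comp (@measurable_sqmod R)).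
  by apply: measurable_fun_pair; [exact: measurable_Re_coord|exact: measurable_Im_coord].
have fi0 i : (\int[mu]_M (f i M)%:E = \int[mu]_M (f 0 M)%:E)%E.
  pose V : 'M[cplx R]_n.+1 := tperm_mx 0 i.
  have VU : V \is unitarymx.
    by apply/unitarymxP; rewrite tr_tperm_mx map_perm_mx -perm_mxM perm.tperm2 perm_mx1.
  have h A (mA : measurable A) := muV V A VU mA.
  have mf0 : measurable_fun setT (EFin \o f 0) by exact/measurable_EFinP.
  rewrite -(ge0_integral_image (measurable_mulmxl V) h mf0); last first.
    by move=> M; rewrite lee_fin sqmod_ge0.
  apply: eq_integral => M _; rewrite /f /= -/V; congr (sqmod (re_im _))%:E.
  by rewrite -xrowE mxE perm.tpermL.
have h0 A (mA : measurable A) : mu [set M | A (corner M)] = corner_law A by [].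
have mS : measurable_fun setT (EFin \o @sqmod R).
  by apply/measurable_EFinP; exact: measurable_sqmod.
have S0 p : (0 <= (EFin \o @sqmod R) p)%E by rewrite lee_fin sqmod_ge0.
have ri := corner_rotation_invariant.
have I0 : (\int[corner_law]_p (sqmod p)%:E = \int[mu]_M (f 0 M)%:E)%E.
  by rewrite -(ge0_integral_image measurable_corner h0 mS S0).
have fin0 : (\int[mu]_M (f 0 M)%:E)%E \is a fin_num.
  by rewrite -I0; exact: integrable_fin_num (integrable_sqmod ri).
have tot : (\int[mu]_M (\sum_(i < n.+1) (f i M)%:E) = 1)%E.
  rewrite (@ae_eq_integral _ _ _ mu setT (cst 1%E)) //.
  - by rewrite integral_cst// mul1e; exact: probability_setT.
  - by apply: emeasurable_sum => i; exact/measurable_EFinP.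
  apply: filterS (ae_unitary mu0) => M MU _; rewrite sumEFin; congr EFin.
  have := MU; rewrite -trmx_unitary => /(sum_sqmod_row 0) <-.
  by apply: eq_bigr => i _; rewrite /f mxE.
move: tot; rewrite ge0_integral_sum//; last 2 first.
- by move=> i; exact/measurable_EFinP.
- by move=> i M _; rewrite lee_fin sqmod_ge0.
rewrite (eq_bigr (fun=> (\int[mu]_M (f 0 M)%:E)%E)) => [|i _]; last exact: fi0.
rewrite -(fineK fin0) sumEFin sumr_const card_ord => -[tot].
rewrite /Rintegral I0; apply: (@mulfI _ n.+1%:R); first by rewrite pnatr_eq0.
by rewrite divff ?pnatr_eq0// mulr_natl.
Qed.

End corner_law.

(** * Moments of the log determinant along the reduction in size *)

Section moment_sequences.
Context (R : realType).

(** All that is kept of the moments of [log |1 - c|] for the corner [c] of a matrix of size [n + 1],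
    where [E |c|^2 = 1 / (n + 1)]. *)
Record factor_moments (n : nat) (a : nat -> R) : Prop := FactorMoments {
  factor_moment0 : a 0 = 1;
  factor_moment1 : a 1%N = 0;
  factor_moment2 : n.+1%:R^-1 / 32 <= a 2%N;
  factor_moment_le : forall m, (2 <= m)%N ->
    `|a m| <= logmod_moment_cst R m / n.+1%:R }.

(** Moments of a sum of [n] independent factors, obtained by the binomial recursion from the empty
    sum. It is a relation because a factor is known only through the bounds above; the asymptotics
    then concern sequences of numbers alone. *)
Inductive moment_seq : nat -> (nat -> R) -> Prop :=
| moment_seq0 M : (forall k, M k = (k == 0)%:R) -> moment_seq 0 M
| moment_seqS n a M M' : moment_seq n M -> factor_moments n a ->
    (forall k, M' k = \sum_(i < k.+1) 'C(k, i)%:R * a (k - i)%N * M i) ->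
    moment_seq n.+1 M'.

End moment_sequences.

Section log_characteristic.
Context (R : realType).

Definition logdet (n : nat) (M : mxborel R n) : R :=
  ln (ComplexField.Normc.normc (\det (1%:M - (M : 'M[cplx R]_n)))).

Lemma ln_normc (z : cplx R) :
  ln (ComplexField.Normc.normc z) = ln (sqmod (re_im z)) / 2.
Proof.
have -> : ComplexField.Normc.normc z = Num.sqrt (sqmod (re_im z)) by case: z.
have [s0|s0] := leP (sqmod (re_im z)) 0.
  by rewrite ler0_sqrtr// !ln0// mul0r.
rewrite -[in RHS](sqr_sqrtr (ltW s0)) lnXn ?sqrtr_gt0// -[_ *+ 2]mulr_natr.
by rewrite mulfK.
Qed.

Lemma logmod_corner (n : nat) (M : mxborel R n.+1) :
  logmod (corner M) = ln (ComplexField.Normc.normc (1 - (M : 'M[cplx R]_n.+1) 0 0)).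
Proof.
rewrite ln_normc /logmod /corner; congr (ln _ / 2).
by case: (fun_of_matrix _ 0 0) => x y; rewrite /sqdist1 /sqmod /= sub0r sqrrN.
Qed.

Lemma measurable_logdet (n : nat) : measurable_fun setT (@logdet n).
Proof.
rewrite (_ : @logdet n = fun M : mxborel R n =>
    ln (sqmod (re_im (\det (1%:M - (M : 'M[cplx R]_n))))) / 2); last first.
  by apply/funext => M; rewrite /logdet ln_normc.
apply: measurable_funM => //; apply: (measurableT_comp (@measurable_ln R)).
apply: measurable_sqr_modulus.
apply: (@cmeasurable_det R _ _ n (fun M : mxborel R n => (1%:M - (M : 'M[cplx R]_n)) : mxborel R n)).
apply: measurable_mxborel => i j.
rewrite (_ : (fun M => _) = fun M : mxborel R n =>
    (1%:M : 'M[cplx R]_n) i j - (M : 'M[cplx R]_n) i j); last first.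
  by apply/funext => M; rewrite !mxE.
by apply: cmeasurableB; [exact: cmeasurable_cst|exact: cmeasurable_coord].
Qed.

Lemma normc_gt0 (z : cplx R) : z != 0 -> 0 < ComplexField.Normc.normc z.
Proof.
move=> z0; rewrite lt_neqAle; apply/andP; split.
  by rewrite eq_sym; apply: contra_neq z0; exact: ComplexField.Normc.eq0_normc.
by case: z {z0} => a b /=; exact: sqrtr_ge0.
Qed.

Lemma logdet_cayley (n : nat) (M : mxborel R n.+1) :
  (M : 'M[cplx R]_n.+1) 0 0 != 1 ->
  \det (1%:M - (cayley_fun M : 'M[cplx R]_n)) != 0 ->
  logdet M = logmod (corner M) + logdet (cayley_fun M).
Proof.
move=> M1 d0; rewrite logmod_corner /logdet.
rewrite (det_1_sub_cayley_minor M1) ComplexField.Normc.normcM lnM// posrE normc_gt0//.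
by rewrite subr_eq0 eq_sym.
Qed.

Definition singular_set (n : nat) : set (mxborel R n) :=
  [set M | \det (1%:M - (M : 'M[cplx R]_n)) = 0].

Lemma measurable_singular_set (n : nat) : measurable (@singular_set n).
Proof.
apply: cmeasurable_eq.
apply: (@cmeasurable_det R _ _ n (fun M : mxborel R n => (1%:M - (M : 'M[cplx R]_n)) : mxborel R n)).
apply: measurable_mxborel => i j.
rewrite (_ : (fun M => _) = fun M : mxborel R n =>
    (1%:M : 'M[cplx R]_n) i j - (M : 'M[cplx R]_n) i j); last first.
  by apply/funext => M; rewrite !mxE.
by apply: cmeasurableB; [exact: cmeasurable_cst|exact: cmeasurable_coord].
Qed.

Lemma corner1_null (n : nat) (mu : probability (mxborel R n.+1) R) :
  left_invariant mu -> mu [set M | (M : 'M[cplx R]_n.+1) 0 0 = 1] = 0%E.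
Proof.
move=> /corner_rotation_invariant/sqdist1_eq0_null <-.
congr (mu _); apply/seteqP; split => M /=.
  by rewrite /corner => ->; rewrite /sqdist1 /= subrr expr0n addr0.
rewrite /corner; case: (fun_of_matrix _ 0 0) => x y; rewrite /sqdist1 /= => h.
have := sqr_ge0 y; have := sqr_ge0 (1 - x) => x2 y2.
have /eqP : y ^+ 2 = 0 by lra.
have /eqP : (1 - x) ^+ 2 = 0 by lra.
by rewrite !sqrf_eq0 subr_eq0 => /eqP <- /eqP ->.
Qed.

(** [logdet_cayley] adds logarithms only where the determinant of the minor is nonzero, so the
    eigenvalue 1 has to be negligible. A determinant vanishes only if the corner is 1 or the minor
    is singular, which gives an induction on the size. *)
Lemma singular_set_null (n : nat) (mu : probability (mxborel R n) R) :
  left_invariant mu -> mu (@singular_set n) = 0%E.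
Proof.
elim: n mu => [|n ih] mu muinv.
  rewrite (_ : @singular_set 0 = set0) ?measure0// -subset0 => M.
  by rewrite /singular_set /= det_mx00 => /eqP; rewrite oner_eq0.
have c1 := corner1_null muinv.
have mc1 : measurable [set M : mxborel R n.+1 | (M : 'M[cplx R]_n.+1) 0 0 = 1].
  by apply: cmeasurable_eq; exact: cmeasurable_coord.
have := ih _ (cayley_law_left_invariant muinv c1) => ih0.
have mpre := measurable_preimage (@measurable_cayley_fun R n) (@measurable_singular_set n).
apply/eqP; rewrite -measure_le0.
apply: (@le_trans _ _ (mu ([set M | (M : 'M[cplx R]_n.+1) 0 0 = 1] `|`
    [set M | singular_set (cayley_fun M)]))).
  apply: le_measure; rewrite ?inE.
  - exact: measurable_singular_set.
  - exact: measurableU.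
  move=> M; rewrite /singular_set /= => M0.
  have [M1|M1] := eqVneq ((M : 'M[cplx R]_n.+1) 0 0) 1; first by left.
  right; move/eqP: M0; rewrite (det_1_sub_cayley_minor M1) mulf_eq0 subr_eq0.
  by rewrite eq_sym (negbTE M1) => /eqP.
apply: (le_trans (measureU2 _ _ _)) => //.
by rewrite [X in (X + _)%E]c1 [X in (_ + X)%E]ih0 adde0.
Qed.

(** The induction ranges over all left invariant probabilities because the smaller one is the law of
    the minor. Integrability travels with it, as the binomial expansion of the next moments requires
    it. *)
Lemma logdet_moment_seq (n : nat) (mu : probability (mxborel R n) R) :
  left_invariant mu ->
  (forall k, mu.-integrable setT (fun M => (logdet M ^+ k)%:E)) /\
  moment_seq n (fun k => \int[mu]_M (logdet M ^+ k)).
Proof.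
elim: n mu => [|n ih] mu muinv.
  have E (M : mxborel R 0) k : logdet M ^+ k = (k == 0)%:R.
    rewrite /logdet det_mx00 ComplexField.Normc.normc1 ln1.
    by case: k => [|k]; rewrite ?expr0// expr0n.
  split=> [k|].
    under eq_fun do rewrite E.
    exact: finite_measure_integrable_cst.
  apply: moment_seq0 => k; under eq_Rintegral do rewrite E.
  rewrite Rintegral_cst// -[RHS]mulr1; congr (_ * _).
  exact: (congr1 fine (probability_setT mu)).
have c1 := corner1_null muinv.
pose nu := @cayley_law R n mu.
have nuinv : left_invariant nu := cayley_law_left_invariant muinv c1.
have [inu snu] := ih nu nuinv.
have ri := corner_rotation_invariant muinv.
pose Xf (M : mxborel R n.+1) := logmod (corner M).
pose Yf (M : mxborel R n.+1) := logdet (cayley_fun M).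
have mX : measurable_fun setT Xf.
  exact: (measurableT_comp (@measurable_logmod R) (@measurable_corner R n)).
have mY : measurable_fun setT Yf.
  exact: (measurableT_comp (@measurable_logdet n) (@measurable_cayley_fun R n)).
have XY (A B : set R) : measurable A -> measurable B ->
    mu ([set M | A (Xf M)] `&` [set M | B (Yf M)]) =
    (mu [set M | A (Xf M)] * mu [set M | B (Yf M)])%E.
  move=> mA mB.
  have mB' := measurable_preimage (@measurable_logdet n) mB.
  have mA' : measurable [set M | A (Xf M)] := measurable_preimage mX mA.
  have Ainv (W : 'M[cplx R]_n) (M : mxborel R n.+1) : W \is unitarymx ->
      [set M | A (Xf M)] (block_mx 1%:M 0 0 W *m (M : 'M[cplx R]_(1 + n))) <->
      [set M | A (Xf M)] M.
    by move=> _; rewrite /= /Xf /corner block_mulmx00.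
  exact: (cayley_minor_independent muinv c1 mA' mB' Ainv).
have hX A (mA : measurable A) : mu [set M | A (corner M)] = corner_law mu A by [].
have hY A (mA : measurable A) : mu [set M | A (cayley_fun M)] = nu A by [].
have mXk k : measurable_fun setT (fun p : R * R => (logmod p ^+ k)%:E).
  by apply/measurable_EFinP/measurable_funX; exact: measurable_logmod.
have mYk k : measurable_fun setT (fun M : mxborel R n => (logdet M ^+ k)%:E).
  by apply/measurable_EFinP/measurable_funX; exact: measurable_logdet.
have iX k : mu.-integrable setT (fun M => (Xf M ^+ k)%:E).
  by apply/(integrable_image (@measurable_corner R n) hX (mXk k)); exact: integrable_logmod_pow.
have iY k : mu.-integrable setT (fun M => (Yf M ^+ k)%:E).
  by apply/(integrable_image (@measurable_cayley_fun R n) hY (mYk k)); exact: inu.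
have eX k : \int[mu]_M (Xf M ^+ k) = \int[corner_law mu]_p (logmod p ^+ k).
  congr fine; apply: (integral_image (@measurable_corner R n) hX (mXk k)).
  exact: integrable_logmod_pow.
have eY k : \int[mu]_M (Yf M ^+ k) = \int[nu]_M (logdet M ^+ k).
  by congr fine; apply: (integral_image (@measurable_cayley_fun R n) hY (mYk k)).
have aeE : {ae mu, forall M, logdet M = Xf M + Yf M}.
  exists ([set M | (M : 'M[cplx R]_n.+1) 0 0 = 1] `|` [set M | singular_set (cayley_fun M)]).
  have mc1 : measurable [set M : mxborel R n.+1 | (M : 'M[cplx R]_n.+1) 0 0 = 1].
    by apply: cmeasurable_eq; exact: cmeasurable_coord.
  have mpre := measurable_preimage (@measurable_cayley_fun R n) (@measurable_singular_set n).
  split.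
  - exact: measurableU.
  - apply/eqP; rewrite -measure_le0; apply: (le_trans (measureU2 _ _ _)) => //.
    by rewrite [X in (X + _)%E]c1 [X in (_ + X)%E](singular_set_null nuinv) adde0.
  - move=> M /= h; apply: contrapT => /not_orP[/eqP h1 /eqP h2]; apply: h.
    exact: logdet_cayley.
have iXY k := independent_moment_add mX mY XY k iX iY.
have mLk k : measurable_fun setT (fun M : mxborel R n.+1 => (logdet M ^+ k)%:E).
  by apply/measurable_EFinP/measurable_funX; exact: measurable_logdet.
have aek k : ae_eq mu setT (fun M => ((Xf M + Yf M) ^+ k)%:E) (fun M => (logdet M ^+ k)%:E).
  by apply: filterS aeE => M -> _.
have il k : mu.-integrable setT (fun M => (logdet M ^+ k)%:E).
  have /integrableP[mXYk iXYk] := (iXY k).1.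
  apply/integrableP; split => //.
  rewrite (ae_eq_integral (fun M => `|((Xf M + Yf M) ^+ k)%:E|)%E) //.
  - exact: measurableT_comp.
  - exact: measurableT_comp.
  - by apply: filterS aeE => M -> _.
split=> //.
pose a m := \int[corner_law mu]_p (logmod p ^+ m).
apply: (@moment_seqS _ n a _ _ snu); last first.
  move=> k; have -> : \int[mu]_M (logdet M ^+ k) = \int[mu]_M ((Xf M + Yf M) ^+ k).
    congr fine; apply: ae_eq_integral => //.
    - exact: measurable_int (iXY k).1.
    - exact: ae_eq_sym.
  by rewrite (iXY k).2; apply: eq_bigr => i _; rewrite eX eY.
have Ssq := corner_sqmod_mean muinv.
split.
- rewrite /a; under eq_Rintegral do rewrite expr0.
  by rewrite Rintegral_cst// mul1r; exact: (congr1 fine (probability_setT (corner_law mu))).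
- by rewrite /a -[RHS](integral_logmod0 ri); under eq_Rintegral do rewrite expr1.
- by rewrite -Ssq; exact: integral_logmod_sqr_lower.
- by move=> m m2; rewrite -Ssq; exact: normr_integral_logmod_pow.
Qed.

End log_characteristic.

(** * Asymptotics of the moment recursion *)

Section moment_asymptotics.
Context (R : realType).
Implicit Types (M a : nat -> R) (n k : nat).

(** The double factorials [(k - 1)!!] for even [k] and 0 for odd [k], through the recursion that
    integration by parts produces. *)
Fixpoint gauss_moment k : R :=
  match k with
  | 0 => 1 | 1 => 0 | k'.+2 => k'.+1%:R * gauss_moment k'
  end.

Lemma gauss_moment_ge0 k : 0 <= gauss_moment k.
Proof.
elim/ltn_ind: k => -[|[|k]] ih //=; rewrite mulr_ge0//; exact: ih.
Qed.

Lemma gauss_moment_odd k : odd k -> gauss_moment k = 0.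
Proof.
elim/ltn_ind: k => -[|[|k]] ih //=; rewrite negbK => ok.
by rewrite ih ?mulr0.
Qed.

Lemma factor_moment2_gt0 n a : factor_moments n a -> 0 < a 2.
Proof.
move=> fa; apply: lt_le_trans (factor_moment2 fa).
by rewrite divr_gt0// invr_gt0.
Qed.

Lemma moment_step_low n a M : factor_moments n a -> M 0 = 1 -> M 1 = 0 ->
  [/\ \sum_(i < 1) 'C(0, i)%:R * a (0 - i)%N * M i = 1,
      \sum_(i < 2) 'C(1, i)%:R * a (1 - i)%N * M i = 0 &
      \sum_(i < 3) 'C(2, i)%:R * a (2 - i)%N * M i = M 2 + a 2].
Proof.
move=> fa M0 M1; rewrite !big_ord_recl !big_ord0 /= /bump /= !add1n.
rewrite !subn0 !subSS ?subnn M0 M1 (factor_moment0 fa) (factor_moment1 fa) !bin0.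
by split; rewrite ?binn; ring.
Qed.

(** The mean is 0, so [M 2] is the variance and adds up over the factors. The first factor alone
    contributes [1/32], and the harmonic sum dominates the logarithm through
    [ln (n+2) - ln (n+1) <= 1 / (n+1)]. *)
Lemma moment_seq_low n M : moment_seq n M ->
  [/\ M 0 = 1, M 1 = 0, 0 <= M 2, ((0 < n)%N -> 32^-1 <= M 2) &
      ln n.+1%:R / 32 <= M 2].
Proof.
elim=> {n M} [M ME|n a M M' sM [M0 M1 M2 Mpos Mln] fa M'E].
  by rewrite !ME; split=> //; rewrite ln1 mul0r.
have [e0 e1 e2] := moment_step_low fa M0 M1.
rewrite !M'E e0 e1 e2; have v0 := factor_moment2_gt0 fa; have := factor_moment2 fa.
move=> v1; split => //; first lra.
  move=> _; case: n sM fa Mpos Mln M'E v1 => [|n] sM fa Mpos Mln M'E v1.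
    by move: v1; rewrite invr1; lra.
  by have := Mpos isT; lra.
have n0 : 0 < n.+1%:R :> R by [].
have : ln n.+2%:R - ln n.+1%:R <= n.+1%:R^-1 :> R.
  rewrite -ln_div ?posrE// (_ : n.+2%:R / n.+1%:R = 1 + n.+1%:R^-1).
    by rewrite le_ln1Dx// (lt_trans (ltrN10 _))// invr_gt0.
  by rewrite -natr1 mulrDl mulfV ?gt_eqF// mul1r.
move: v1 Mln; move: (_^-1) (ln _) (ln _) => x y z; lra.
Qed.

(** Second order Taylor remainder. The coefficient [(r+1)^2] is crude but survives the induction, as
    [(r+1)^2 + (r+2) <= (r+2)^2]. *)
Lemma pow_remainder (s v : R) (r : nat) : 0 <= s -> 0 <= v ->
  `|(r.+2)%:R * v * s ^+ r.+1 - ((s + v) ^+ r.+2 - s ^+ r.+2)| <=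
    (r.+1)%:R ^+ 2 * v ^+ 2 * (s + v) ^+ r.
Proof.
move=> s0 v0; have t0 : 0 <= s + v by rewrite addr_ge0.
suff /andP[h1 h2] : 0 <= (s + v) ^+ r.+2 - s ^+ r.+2 - (r.+2)%:R * v * s ^+ r.+1
    <= (r.+1)%:R ^+ 2 * v ^+ 2 * (s + v) ^+ r.
  by rewrite distrC ger0_norm.
elim: r => [|r /andP[ih1 ih2]].
  rewrite !expr1 expr0; apply/andP; split; first by have := sqr_ge0 v; lra.
  by lra.
set x := _ - _ - _ in ih1 ih2.
have -> : (s + v) ^+ r.+3 - s ^+ r.+3 - r.+3%:R * v * s ^+ r.+2 =
    (s + v) * x + r.+2%:R * v ^+ 2 * s ^+ r.+1.
  rewrite /x -[r.+3%:R]natr1 !exprS expr0.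
  by move: (r.+2%:R) (s ^+ r) ((s + v) ^+ r) => c S A; ring.
apply/andP; split.
  by rewrite addr_ge0// !mulr_ge0// ?exprn_ge0.
have st : s ^+ r.+1 <= (s + v) ^+ r.+1 by rewrite lerXn2r ?nnegrE// lerDl.
apply: (@le_trans _ _ ((s + v) * (r.+1%:R ^+ 2 * v ^+ 2 * (s + v) ^+ r) +
    r.+2%:R * v ^+ 2 * (s + v) ^+ r.+1)).
  rewrite lerD//; first by rewrite ler_wpM2l.
  by rewrite ler_wpM2l// mulr_ge0// sqr_ge0.
have -> : (s + v) * (r.+1%:R ^+ 2 * v ^+ 2 * (s + v) ^+ r) +
    r.+2%:R * v ^+ 2 * (s + v) ^+ r.+1 =
    (r.+1%:R ^+ 2 + r.+2%:R) * (v ^+ 2 * (s + v) ^+ r.+1).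
  by rewrite [(s + v) ^+ r.+1]exprS; ring.
rewrite -mulrA ler_wpM2r//; first by rewrite mulr_ge0 ?exprn_ge0// sqr_ge0.
rewrite -[r.+2%:R]natr1; have : 0 <= r.+1%:R :> R by []; nra.
Qed.

(** The variance is only known to exceed [1/32], not 1, so raising an exponent costs a factor 32
    each time. *)
Lemma pow_le_shift (t : R) (i j m : nat) : 32^-1 <= t -> (i <= j)%N -> (j <= m)%N ->
  t ^+ i <= 32 ^+ m * t ^+ j.
Proof.
move=> t1 ij jm; have t0 : 0 <= t by lra.
apply: (@le_trans _ _ ((32 * t) ^+ j)).
  apply: (@le_trans _ _ ((32 * t) ^+ i)).
    by rewrite exprMn ler_peMl ?exprn_ge0// exprn_ege1//; lra.
  by rewrite ler_weXn2l//; lra.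
by rewrite exprMn ler_wpM2r ?exprn_ge0// ler_weXn2l//; lra.
Qed.

Lemma moment_step_split n a M (j : nat) : factor_moments n a ->
  \sum_(i < j.+3) 'C(j.+2, i)%:R * a (j.+2 - i)%N * M i =
  M j.+2 + 'C(j.+2, 2)%:R * a 2%N * M j + (j.+2)%:R * a 1%N * M j.+1 +
  \sum_(i < j) 'C(j.+2, i)%:R * a (j.+2 - i)%N * M i.
Proof.
move=> fa; pose F i := 'C(j.+2, i)%:R * a (j.+2 - i)%N * M i.
rewrite -(big_mkord xpredT F) -(big_mkord xpredT F).
rewrite (big_nat_recr j.+2)// (big_nat_recr j.+1)// (big_nat_recr j)//.
rewrite {2 3 4}/F subnn subSnn (_ : j.+2 - j = 2)%N; last by lia.
rewrite (factor_moment0 fa) binn binSn (_ : 'C(j.+2, j) = 'C(j.+2, 2)).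
  have key (S B x y m m1 m2 c : R) :
    S + B * y * m + c * x * m1 + 1 * 1 * m2 = m2 + B * y * m + c * x * m1 + S by ring.
  exact: key.
by rewrite -bin_sub; [congr binomial; lia|lia].
Qed.

(** Adding a factor of variance [v] changes the moment of order [j + 2] by [C(j+2, 2) v M_j] to
    leading order. Since [C(j+2, 2) g_j = (j/2 + 1) g_(j+2)], this matches the first order change of
    the Gaussian value for even [j]. What remains is the error on [M_j], a Taylor remainder, and the
    terms with factor moments of order at least 3. *)
Lemma moment_step_error (j : nat) (C0 : R) : (0 < j)%N -> 0 <= C0 ->
  exists2 c : R, 0 <= c & forall n a M, factor_moments n a ->
    0 <= M 2 -> 32^-1 <= M 2 + a 2 ->
    (forall i, (i <= j)%N ->
      `|M i - gauss_moment i * M 2 ^+ i./2| <= C0 * M 2 ^+ (i.-1)./2) ->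
    `|'C(j.+2, 2)%:R * a 2 * M j +
      \sum_(i < j) 'C(j.+2, i)%:R * a (j.+2 - i)%N * M i -
      gauss_moment j.+2 * ((M 2 + a 2) ^+ (j./2).+1 - M 2 ^+ (j./2).+1)| <=
    c * (a 2 * (M 2 + a 2) ^+ (j.-1)./2).
Proof.
move=> j0 C00; pose K m : R := logmod_moment_cst R m.
have K0 m : 0 <= K m by exact: logmod_moment_cst_ge0.
pose c1 : R := 'C(j.+2, 2)%:R * C0.
pose c2 : R := gauss_moment j.+2 * j%:R ^+ 2 * K 2.
pose B i : R := gauss_moment i + C0.
pose c3 : R := \sum_(i < j) 'C(j.+2, i)%:R * (32 * K (j.+2 - i)%N) * (B i * 32 ^+ j).
have B0 i : 0 <= B i by rewrite addr_ge0 ?gauss_moment_ge0.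
have c10 : 0 <= c1 by rewrite mulr_ge0.
have c20 : 0 <= c2.
  apply: mulr_ge0 (K0 _); apply: mulr_ge0; first exact: gauss_moment_ge0.
  exact: exprn_ge0.
have c30 : 0 <= c3.
  apply: sumr_ge0 => i _; apply: mulr_ge0.
    by apply: mulr_ge0 => //; exact: mulr_ge0.
  by apply: mulr_ge0 => //; exact: exprn_ge0.
exists (c1 + c2 + c3); first by rewrite !addr_ge0.
move=> n a M fa s0 t1 IH.
have v0 := factor_moment2_gt0 fa; have v1 := factor_moment2 fa.
have K2v : a 2 <= K 2.
  have := factor_moment_le fa (leqnn 2); rewrite ger0_norm; last exact: ltW.
  move/le_trans; apply; rewrite ler_pdivrMr// ler_peMr ?K0//.
  by rewrite ler1n.
(* The lower bound on [v] is of the same order [1 / (n+1)] as the upper bound on the factor moments,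
   so these are at most a multiple of [v]. *)
have Kv i : (i < j)%N -> `|a (j.+2 - i)%N| <= 32 * K (j.+2 - i)%N * a 2.
  move=> ij; have i2 : (2 <= j.+2 - i)%N by clear -ij; lia.
  apply: (le_trans (factor_moment_le fa i2)); rewrite -/(K _).
  rewrite [32 * _]mulrC -mulrA ler_wpM2l//.
  by move: v1; move: (_^-1) (a 2) => x y; lra.
move: (M 2) (a 2) s0 t1 v0 K2v Kv IH {v1} => s v s0 t1 v0 K2v Kv IH.
set t := s + v in t1 *; set q := (j.-1)./2.
have t0 : 0 <= t by rewrite addr_ge0// ltW.
have st : s <= t by rewrite lerDl ltW.
have stX m : s ^+ m <= t ^+ m by rewrite lerXn2r ?nnegrE.
have tq0 : 0 <= t ^+ q by rewrite exprn_ge0.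
have vtq0 : 0 <= v * t ^+ q by rewrite mulr_ge0// ltW.
pose T1 := 'C(j.+2, 2)%:R * v * (M j - gauss_moment j * s ^+ j./2).
pose T2 := 'C(j.+2, 2)%:R * v * (gauss_moment j * s ^+ j./2) -
   gauss_moment j.+2 * (t ^+ (j./2).+1 - s ^+ (j./2).+1).
pose T3 := \sum_(i < j) 'C(j.+2, i)%:R * a (j.+2 - i)%N * M i.
have -> : 'C(j.+2, 2)%:R * v * M j + T3 -
    gauss_moment j.+2 * (t ^+ (j./2).+1 - s ^+ (j./2).+1) = T1 + T2 + T3.
  by rewrite /T1 /T2; move: T3 ('C(_, _)) => T3 b; ring.
have hT1 : `|T1| <= c1 * (v * t ^+ q).
  rewrite /T1 !normrM (ger0_norm (ltW v0)) ger0_norm//.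
  rewrite /c1 -!mulrA ler_wpM2l// mulrCA ler_wpM2l ?(ltW v0)//.
  by apply: (le_trans (IH j (leqnn j))); rewrite ler_wpM2l.
have hT2 : `|T2| <= c2 * (v * t ^+ q).
  (* For odd [j] both Gaussian moments vanish; for even [j] the leading terms cancel exactly,
     leaving [v^2 t^q], of which one factor [v] is absorbed by [K 2]. *)
  have [oj|ej] := boolP (odd j).
    have gj : gauss_moment j = 0 by exact: gauss_moment_odd.
    by rewrite /T2 /= gj !(mulr0, mul0r) subr0 normr0 mulr_ge0.
  have j2 : j = (q.+1).*2 by rewrite /q; clear -ej j0; lia.
  have jh : j./2 = q.+1 by rewrite j2 doubleK.
  have CE : 'C(j.+2, 2)%:R = q.+2%:R * j.+1%:R :> R.
    have jq : j.+2 = (q.+2).*2 by rewrite [in LHS]j2.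
    by rewrite -natrM bin2 [_.-1]/= jq -doubleMl doubleK.
  have -> : T2 = gauss_moment j.+2 *
      (q.+2%:R * v * s ^+ q.+1 - ((s + v) ^+ q.+2 - s ^+ q.+2)).
    rewrite /T2 jh CE /= -/t.
    move: (q.+2%:R) (j.+1%:R) (gauss_moment j) (s ^+ q.+1) (t ^+ q.+2) (s ^+ q.+2) => x1 x2 x3 x4 x5 x6.
    ring.
  rewrite normrM /c2; move: (gauss_moment j.+2) (gauss_moment_ge0 j.+2) => g g0.
  rewrite (ger0_norm g0).
  have -> : g * j%:R ^+ 2 * K 2 * (v * t ^+ q) = g * (j%:R ^+ 2 * (K 2 * (v * t ^+ q))).
    by rewrite -!mulrA.
  apply: ler_wpM2l => //.
  apply: (le_trans (pow_remainder q s0 (ltW v0))); rewrite -/t -mulrA.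
  apply: ler_pM.
  - exact: sqr_ge0.
  - by rewrite mulr_ge0// sqr_ge0.
  - by rewrite ler_sqr ?nnegrE// ler_nat; clear -j2; lia.
  - by rewrite expr2 -mulrA ler_wpM2r.
have hT3 : `|T3| <= c3 * (v * t ^+ q).
  rewrite /T3 /c3 mulr_suml; apply: (le_trans (ler_norm_sum _ _ _)).
  apply: ler_sum => i _; rewrite !normrM (ger0_norm (ler0n _ _)).
  have ij := ltn_ord i.
  (* For [i < j] both exponents [i./2] and [i.-1./2] are at most [q], so the main term and the error
     of [M i] are of order [t^q]. *)
  have hM : `|M i| <= B i * 32 ^+ j * t ^+ q.
    have hi := IH i (ltnW ij).
    have iq : (i./2 <= q)%N by rewrite /q half_leq//; clear -ij; lia.
    have iq' : (i.-1./2 <= q)%N by rewrite /q half_leq//; clear -ij; lia.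
    have qk : (q <= j)%N by rewrite /q; clear; lia.
    have h1 := le_trans (stX i./2) (pow_le_shift t1 iq qk).
    have h2 := le_trans (stX i.-1./2) (pow_le_shift t1 iq' qk).
    rewrite -[M i](subrK (gauss_moment i * s ^+ i./2)).
    apply: (le_trans (ler_normD _ _)); rewrite -mulrA /B mulrDl addrC.
    apply: lerD; last by apply: (le_trans hi); rewrite ler_wpM2l.
    rewrite normrM (ger0_norm (gauss_moment_ge0 _)) ger0_norm ?exprn_ge0//.
    by rewrite ler_wpM2l ?gauss_moment_ge0.
  rewrite -!mulrA; apply: ler_wpM2l => //.
  apply: (le_trans (ler_pM _ _ (Kv i ij) hM)) => //.
  move: (K _) (B i) (32 ^+ j) (t ^+ q) => x1 x2 x3 x4.
  by rewrite le_eqVlt; apply/orP; left; apply/eqP; ring.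
rewrite !mulrDl; apply: (le_trans (ler_normD _ _)); apply: lerD => //.
by apply: (le_trans (ler_normD _ _)); exact: lerD.
Qed.

(** For even [k] the error is one power of the variance below the main term. For odd [k] the main
    term is 0 and this says that [M k] is of order [s^((k-1)/2)]. *)
Definition moment_error_le k (C : R) : Prop := forall n M, moment_seq n M ->
  `|M k - gauss_moment k * M 2 ^+ k./2| <= C * M 2 ^+ (k.-1)./2.

Lemma moment_error_uniform m :
  (forall k, (k <= m)%N -> exists2 C : R, 0 <= C & moment_error_le k C) ->
  exists2 C : R, 0 <= C & forall k, (k <= m)%N -> moment_error_le k C.
Proof.
elim: m => [|m ihm] ih.
  have [C C0 hC] := ih 0 isT; exists C => // k; rewrite leqn0 => /eqP ->.
  exact: hC.
have [C C0 hC] := ihm (fun k km => ih k (leqW km)).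
have [D D0 hD] := ih m.+1 (leqnn _).
exists (C + D); first by rewrite addr_ge0.
move=> i; rewrite leq_eqVlt ltnS => /predU1P[->|im] n M sM.
  have [_ _ M2 _ _] := moment_seq_low sM.
  by apply: (le_trans (hD n M sM)); rewrite ler_wpM2r ?exprn_ge0// lerDr.
have [_ _ M2 _ _] := moment_seq_low sM.
by apply: (le_trans (hC i im n M sM)); rewrite ler_wpM2r ?exprn_ge0// lerDl.
Qed.

(** Strong induction on the order, then induction on the number of factors. The constant is the [c]
    of one step, and it does not grow: [c s^(q+1) + c v t^q <= c (s + v) t^q = c t^(q+1)]. *)
Lemma moment_error k : exists2 C : R, 0 <= C & moment_error_le k C.
Proof.
elim/ltn_ind: k => -[|[|j]] ih.
- exists 0 => // n M /moment_seq_low[M0 _ _ _ _].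
  by rewrite M0 /= !expr0 !mulr1 subrr normr0.
- exists 0 => // n M /moment_seq_low[_ M1 _ _ _].
  by rewrite M1 /= !mul0r subrr normr0.
have [->|j0] := posnP j.
  exists 0 => // n M _.
  by rewrite /= mul0r [1%:R * 1]mulr1 mul1r subrr normr0.
have [k kj|C0 C00 IH] := @moment_error_uniform j; first by apply: ih; rewrite ltnS leqW.
have [c c0 step] := moment_step_error j0 C00.
have jq : j.+2.-1./2 = ((j.-1)./2).+1 by clear -j0; lia.
exists c => // n M; elim=> {n M} [M ME|n a M M' sM ihM fa M'E].
  by rewrite !ME /= !expr0n /= mulr0 subr0 normr0 mulr_ge0.
have [M0 M1 s0 _ _] := moment_seq_low sM.
have [_ _ _ /(_ isT) t1 _] := moment_seq_low (moment_seqS sM fa M'E).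
have v0 := factor_moment2_gt0 fa.
have [_ _ e2] := moment_step_low fa M0 M1.
have tE : M' 2 = M 2 + a 2 by rewrite M'E e2.
rewrite tE in t1; have := step n a M fa s0 t1 (fun i ij => IH i ij n M sM).
move: ihM; rewrite jq tE M'E (moment_step_split _ _ fa) (factor_moment1 fa).
rewrite mulr0 mul0r addr0.
have -> : j.+2./2 = (j./2).+1 by [].
move: (\sum_(i < j) _) (gauss_moment j.+2) ('C(j.+2, 2)%:R) => S g b.
move: (M 2) (a 2) s0 v0 (M j.+2) (M j) => s v s0 v0 m2 m ihM hstep.
have st : s <= s + v by rewrite lerDl ltW.
have t0 : 0 <= s + v by exact: le_trans st.
have e : m2 + b * v * m + S - g * (s + v) ^+ (j./2).+1 =
    (m2 - g * s ^+ (j./2).+1) +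
    (b * v * m + S - g * ((s + v) ^+ (j./2).+1 - s ^+ (j./2).+1)).
  by move: (_ ^+ _) (_ ^+ _) => x y; ring.
rewrite e; apply: (le_trans (ler_normD _ _)); apply: (le_trans (lerD ihM hstep)).
rewrite -mulrDr ler_wpM2l// !exprS [leRHS]mulrDl lerD2r ler_wpM2l//.
by rewrite lerXn2r ?nnegrE.
Qed.

(** After division by [s^(k/2)] the error is [C / s], and [s >= ln n / 32] accounts for the factor
    32. *)
Lemma normalized_moment_bound k : (4 <= k)%N -> ~~ odd k ->
  exists C : R, forall n M, (2 <= n)%N -> moment_seq n M ->
    `|M k / M 2 ^+ k./2 - gauss_moment k| <= C / ln n%:R.
Proof.
move=> k4 ek; have [C C0 hC] := moment_error k.
exists (32 * C) => n M n2 sM.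
have [_ _ _ spos sln] := moment_seq_low sM.
have s0 : 0 < M 2 by apply: (lt_le_trans _ (spos _)); [rewrite invr_gt0|lia].
have lnn : 0 < ln n%:R :> R by rewrite ln_gt0// ltr1n.
have lnn1 : ln n%:R <= ln n.+1%:R :> R by rewrite ler_ln ?posrE ?ltr0n ?ler_nat//; lia.
have -> : M k / M 2 ^+ k./2 - gauss_moment k =
    (M k - gauss_moment k * M 2 ^+ k./2) / M 2 ^+ k./2.
  by rewrite mulrBl mulfK// gt_eqF// exprn_gt0.
rewrite normrM normfV (ger0_norm (exprn_ge0 _ (ltW s0))).
apply: (@le_trans _ _ (C * M 2 ^+ (k.-1)./2 / M 2 ^+ k./2)).
  apply: ler_wpM2r; last exact: hC sM.
  by rewrite invr_ge0; apply: exprn_ge0; exact: ltW.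
have -> : k./2 = (k.-1./2).+1 by lia.
rewrite exprS invfM mulrACA mulfV ?mulr1 ?gt_eqF ?exprn_gt0//.
rewrite [32 * C]mulrC -mulrA ler_wpM2l//.
rewrite -[32 / _]invf_div lef_pV2 ?posrE ?divr_gt0//.
by apply: le_trans sln; rewrite ler_wpM2r.
Qed.

End moment_asymptotics.

(** * Moments of the normal law *)

Section normal_moments.
Context (R : realType).
Local Notation phi := (@normal_pdf R 0 1).
Local Notation lambda := (@lebesgue_measure R).

Lemma phiE (x : R) : phi x = normal_peak 1 * expR (- (x ^+ 2 / 2)).
Proof.
by rewrite normal_pdfE ?oner_neq0// /normal_fun subr0 expr1n mulNr.
Qed.

Lemma is_derive_phi (x : R) : is_derive x 1 phi (- x * phi x).
Proof.
have h1 : is_derive x 1 (- (@id R ^+ 2) * cst 2^-1) (- x).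
  apply: is_derive_eq; rewrite /= scaler0 add0r /cst /= -[_ *: _]/(_ * _).
  by rewrite -[_ *: 1]/(_ * 1) expr1; field.
have h2 := @is_derive1_comp R expR _ x _ _ (is_derive_expR _) h1.
have h3 : is_derive x 1 (cst (normal_peak 1) * (expR \o (- (@id R ^+ 2) * cst 2^-1))) (- x * phi x).
  apply: is_derive_eq; rewrite scaler0 addr0 phiE /cst /= -[_ *: _]/(_ * _).
  rewrite (_ : (_ : R -> R) x = - (x ^+ 2 / 2)) ?mulNr//; ring.
have e : cst (normal_peak 1) * (expR \o (- (@id R ^+ 2) * cst 2^-1)) = phi.
  by apply/funext => y; rewrite phiE /=; congr (_ * expR _); exact: mulNr.
by rewrite e in h3.
Qed.

Lemma continuous_phi : continuous phi.
Proof. exact/continuous_normal_pdf/oner_neq0. Qed.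

Lemma derivable_phi (x : R) : derivable phi x 1.
Proof. by have [] := is_derive_phi x. Qed.

Lemma continuous_derivable_oo (f : R -> R) (a b : R) :
  (forall x, derivable f x 1) -> continuous f -> derivable_oo_LRcontinuous f a b.
Proof.
move=> df cf; split.
- by move=> x _; exact: df.
- by apply: cvg_at_right_filter; exact: cf.
- by apply: cvg_at_left_filter; exact: cf.
Qed.

Definition normal_cutoff (k n : nat) : R :=
  \int[lambda]_(x in `[- n%:R, n%:R]) (x ^+ k * phi x).

Lemma normal_cutoff_integrable (k n : nat) :
  lambda.-integrable `[- n%:R, n%:R] (fun x => (x ^+ k * phi x)%:E).
Proof.
apply: continuous_compact_integrable; first exact: segment_compact.
apply: continuous_subspaceT => x; apply: cvgM; first exact: exprn_continuous.
exact: continuous_phi.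
Qed.

(** Integration by parts with [x phi = (- phi)']. For even [k] the power [x^(k+1)] is odd, so the
    two boundary terms add up; [n.+1] keeps the interval nondegenerate. *)
Lemma normal_cutoff_rec (k n : nat) : ~~ odd k ->
  normal_cutoff k.+2 n.+1 =
  k.+1%:R * normal_cutoff k n.+1 - 2 * (n.+1%:R ^+ k.+1 * phi n.+1%:R).
Proof.
move=> ek; set b : R := n.+1%:R.
have ab : - b < b by rewrite gtrN.
have cX m : continuous (fun x : R => x ^+ m) by move=> x; exact: exprn_continuous.
have dX (m : nat) (x : R) : derivable (fun x : R => x ^+ m) x 1 by exact: exprn_derivable.
have phiN x : phi (- x) = phi x by rewrite !phiE sqrrN.
have := @integration_by_parts R (fun x => x ^+ k.+1) (fun x => - phi x)
  (fun x => k.+1%:R * x ^+ k) (fun x => x * phi x) (- b) b ab.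
have -> : (\int[lambda]_(x in `[(- b)%R, b]) (x ^+ k.+1 * (x * phi x))%:E)%E =
    (normal_cutoff k.+2 n.+1)%:E.
  rewrite /normal_cutoff /Rintegral fineK.
    by apply: eq_integral => x _; rewrite mulrA -exprSr.
  exact: integrable_fin_num (normal_cutoff_integrable _ _).
have -> : (\int[lambda]_(x in `[(- b)%R, b]) (k.+1%:R * x ^+ k * - phi x)%:E)%E =
    (- (k.+1%:R * normal_cutoff k n.+1))%:E.
  rewrite -mulNr /normal_cutoff -RintegralZl//; last exact: normal_cutoff_integrable.
  rewrite /Rintegral fineK.
    by apply: eq_integral => x _; congr EFin; ring.
  apply: integrable_fin_num => //.
  have h : lambda.-integrable `[- b, b]
      (fun x => ((- k.+1%:R)%:E * (x ^+ k * phi x)%:E)%E).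
    by apply: integrableZl => //; exact: normal_cutoff_integrable.
  by apply: eq_integrable h => // x _; rewrite EFinM.
rewrite -EFinB => h; apply: EFin_inj; rewrite h; first last.
- move=> x _; rewrite derive1E.
  have := is_derive_phi x => hd.
  have [_ ->] := is_deriveN hd.
  by rewrite mulNr opprK.
- apply: continuous_derivable_oo.
    by move=> x; apply: derivableN; exact: derivable_phi.
  by move=> x; apply: cvgN; exact: continuous_phi.
- apply: continuous_subspaceT => x; apply: cvgM; first exact: cvg_id.
  exact: continuous_phi.
- by move=> x _; rewrite exp_derive1.
- exact: continuous_derivable_oo.
- apply: continuous_subspaceT => x; apply: cvgM; first exact: cvg_cst.
  exact: cX.
congr EFin; rewrite phiN exprNn -signr_odd /= ek /=; ring.
Qed.

End normal_moments.

Section normal_moments_limit.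
Context (R : realType).
Local Notation phi := (@normal_pdf R 0 1).
Local Notation lambda := (@lebesgue_measure R).
Local Notation nu := (@normal_prob R 0 1).

Lemma normal_tail_cvg0 (k : nat) :
  n.+1%:R ^+ k.+1 * phi n.+1%:R @[n --> \oo] --> (0 : R).
Proof.
(* From [e^(b^2/2) >= (b^2/2)^(k+2) / (k+2)!] and [b^(k+2) <= b^(2(k+2))] for [b >= 1], the boundary
   term is at most [D / b]. *)
pose D : R := normal_peak 1 * (2 ^+ k.+2 * (k.+2)`!%:R).
have D0 : 0 <= D by rewrite mulr_ge0 ?normal_peak_ge0// mulr_ge0// exprn_ge0.
apply: (@squeeze_cvgr _ _ _ _ (cst 0) (fun n => D * harmonic n)).
- apply: nearW => n; rewrite mulr_ge0 ?exprn_ge0 ?normal_pdf_ge0//=.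
  rewrite phiE; set b : R := n.+1%:R.
  have b0 : 0 < b by [].
  have b1 : 1 <= b by rewrite ler1n.
  have h0 : 0 <= b ^+ 2 / 2 by rewrite divr_ge0// sqr_ge0.
  have he : (b ^+ 2 / 2) ^+ k.+2 / (k.+2)`!%:R <= expR (b ^+ 2 / 2).
    by apply: le_trans (@expR_ge1Dxn R _ k.+1 h0); rewrite lerDr.
  rewrite /harmonic /= -/b expRN [leLHS]mulrCA.
  have -> : D / b = normal_peak 1 * ((2 ^+ k.+2 * (k.+2)`!%:R) / b) by exact: esym (mulrA _ _ _).
  apply: ler_wpM2l; first exact: normal_peak_ge0.
  rewrite ler_pdivrMr ?expR_gt0// mulrAC ler_pdivlMr//.
  rewrite -exprSr; apply: (@le_trans _ _ (b ^+ (2 * k.+2))).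
    by rewrite ler_weXn2l//; lia.
  have : b ^+ (2 * k.+2) = 2 ^+ k.+2 * (k.+2)`!%:R * ((b ^+ 2 / 2) ^+ k.+2 / (k.+2)`!%:R).
    rewrite expr_div_n -exprM; field.
    by rewrite expf_neq0//= pnatr_eq0 -lt0n fact_gt0.
  move=> ->; rewrite ler_wpM2l// mulr_ge0// exprn_ge0//.
- exact: cvg_cst.
- rewrite -[X in _ --> X](mulr0 D); apply: cvgM; [exact: cvg_cst|exact: cvg_harmonic].
Qed.

(** The Radon-Nikodym derivative of the normal law agrees almost everywhere with its density, both
    having the same integrals over measurable sets. *)
Lemma integral_normal_prob_cutoff (k n : nat) :
  (\int[nu]_(x in `[(- n%:R)%R, n%:R]) (x ^+ k)%:E)%E = (normal_cutoff R k n)%:E.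
Proof.
have mXR : measurable_fun [set: measurableTypeR R] (fun x => x ^+ k : R).
  exact: (@exprn_measurable R setT k).
have mX : measurable_fun [set: measurableTypeR R] (fun x => (x ^+ k)%:E : \bar R).
  by apply/measurable_EFinP; exact: mXR.
have mI : measurable (`[- n%:R, n%:R]%classic : set R) by exact: measurable_itv.
have inu : nu.-integrable `[- n%:R, n%:R] (fun x : R => (x ^+ k)%:E).
  apply: (@measurable_bounded_integrable _ _ _ nu (fun x => x ^+ k)) => //.
    by rewrite (le_lt_trans (probability_le1 _ _))// ltry.
  exists (n%:R ^+ k); split; first by rewrite num_real.
  move=> M kM x /=; rewrite in_itv /= => xn; rewrite (le_trans _ (ltW kM))//.
  by rewrite normrX lerXn2r ?nnegrE// ler_norml.
have mphi : measurable_fun [set: measurableTypeR R] (fun x => (phi x)%:E).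
  by apply/measurable_EFinP; exact: (@measurable_normal_pdf R 0 1).
rewrite -(Radon_Nikodym_change_of_variables (normal_prob_dominates 0 1))//=.
rewrite /normal_cutoff /Rintegral fineK; last first.
  exact: integrable_fin_num (normal_cutoff_integrable _ _ _).
under [RHS]eq_integral do rewrite EFinM.
apply: ae_eq_integral => //.
- apply: emeasurable_funM; first exact: measurable_funTS.
  apply: (measurable_int lambda).
  apply: (integrableS _ _ (@subsetT _ _)) => //=.
  by apply: Radon_Nikodym_integrable; exact: normal_prob_dominates.
- by apply: emeasurable_funM; exact: measurable_funTS.
- apply: ae_eqe_mul2l => /=.
  rewrite Radon_NikodymE//=; first exact: normal_prob_dominates.
  move=> dom; case: cid => /= h [h1 h2 h3].
  apply: integral_ae_eq => //=.
  + exact: integrableS h2.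
  + exact: measurable_funTS.
  + by move=> E _ mE; rewrite -h3.
Qed.

(** Even powers are nonnegative, so monotone convergence along growing intervals applies with no
    prior knowledge of integrability. *)
Lemma integral_normal_prob_cvg (k : nat) : ~~ odd k ->
  (normal_cutoff R k n.+1)%:E @[n --> \oo] --> (\int[nu]_x (x ^+ k)%:E)%E.
Proof.
move=> ek; pose F (n : nat) : set (measurableTypeR R) := `[- n.+1%:R, n.+1%:R]%classic.
have FT : \bigcup_n F n = setT.
  apply/seteqP; split => // x _; exists (Num.bound `|x|) => //.
  rewrite /F /= in_itv /= -ler_norml ltW//.
  by rewrite (lt_le_trans (archi_boundP (normr_ge0 x)))// ler_nat.
have mXR : measurable_fun [set: measurableTypeR R] (fun x => x ^+ k : R).
  exact: (@exprn_measurable R setT k).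
have mX : measurable_fun [set: measurableTypeR R] (fun x => (x ^+ k)%:E : \bar R).
  by apply/measurable_EFinP; exact: mXR.
under eq_fun do rewrite -integral_normal_prob_cutoff.
have := @ge0_nondecreasing_set_cvg_integral _ (measurableTypeR R) R F
  (fun x => (x ^+ k)%:E) nu.
rewrite FT; apply.
- apply/nondecreasing_seqP => n; rewrite subsetEset => x.
  rewrite /F /= !in_itv /= => /andP[h1 h2]; apply/andP; split.
    by apply: le_trans h1; rewrite lerN2 ler_nat.
  by apply: le_trans h2 _; rewrite ler_nat.
- by move=> n; exact: (measurable_itv `[- n.+1%:R, n.+1%:R]).
- by move=> n; exact: measurable_funTS mX.
- by move=> n x _; rewrite lee_fin exprn_even_ge0.
Qed.

(** The cutoff recursion passes to the limit as its boundary term vanishes; uniqueness of the limit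
    also shows that the next even moment is finite. *)
Lemma integral_normal_prob_pow (k : nat) : ~~ odd k ->
  (\int[nu]_x (x ^+ k)%:E)%E = (gauss_moment R k)%:E.
Proof.
elim/ltn_ind: k => -[|[|k]] ih //= ek.
  under eq_integral do rewrite expr0.
  by rewrite integral_cst// mul1e; exact: probability_setT.
rewrite negbK in ek; have h := integral_normal_prob_cvg ek.
rewrite (ih k (leqnSn _) ek) in h.
have hk : normal_cutoff R k n.+1 @[n --> \oo] --> gauss_moment R k.
  by move/fine_cvgP : h => [_].
have h2 : normal_cutoff R k.+2 n.+1 @[n --> \oo] --> k.+1%:R * gauss_moment R k.
  under eq_fun do rewrite normal_cutoff_rec//.
  have : k.+1%:R * normal_cutoff R k n.+1 - 2 * (n.+1%:R ^+ k.+1 * phi n.+1%:R)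
      @[n --> \oo] --> k.+1%:R * gauss_moment R k - 2 * 0.
    apply: cvgB; first by apply: cvgM; [exact: cvg_cst|exact: hk].
    by apply: cvgM; [exact: cvg_cst|exact: normal_tail_cvg0].
  by rewrite mulr0 subr0.
have ek2 : ~~ odd k.+2 by rewrite /= negbK.
have h3 := integral_normal_prob_cvg ek2.
have h4 : (normal_cutoff R k.+2 n.+1)%:E @[n --> \oo] --> (k.+1%:R * gauss_moment R k)%:E.
  by apply/fine_cvgP; split; [exact: nearW|exact: h2].
exact: (cvg_unique _ h3 h4).
Qed.

End normal_moments_limit.

(** * Moments of Re log Z *)

Section relogZ_moments.
Context (R : realType) (n : nat) (theta : R).
Context (d : measure_display) (T : measurableType d) (P : probability T R).
Context (U : {RV P >-> mxborel R n}).
Hypothesis haarU : haar_unitary (distribution P U).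
Local Notation mu := (distribution P U : probability (mxborel R n) R).

Definition logdet_moment (k : nat) : R := \int[mu]_M (logdet M ^+ k).

Lemma relogZ_logdet (M : 'M[cplx R]_n) :
  relogZ M theta = logdet ((expi (- theta))%:M *m M : mxborel R n).
Proof. by rewrite /relogZ /charpolyZ /logdet mul_scalar_mx. Qed.

Lemma expi_unitary (t : R) : ((expi t)%:M : 'M[cplx R]_n) \is unitarymx.
Proof.
apply/unitarymxP; rewrite tr_scalar_mx map_scalar_mx /= -scalar_mxM mul_conj_sqmod.
by rewrite /sqmod /= cos2Dsin2.
Qed.

(** The phase [e^(-i theta)] is a unitary scalar matrix, absorbed by left invariance, so nothing
    depends on [theta]. *)
Lemma relogZ_moment (k : nat) :
  P.-integrable setT (fun w => (relogZ (U w) theta ^+ k)%:E) /\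
  (\int[P]_w (relogZ (U w) theta ^+ k)%:E = (logdet_moment k)%:E)%E.
Proof.
have muinv := haar_left_invariant haarU.
have [il _] := logdet_moment_seq muinv.
pose V : 'M[cplx R]_n := (expi (- theta))%:M.
pose phi (w : T) : mxborel R n := V *m (U w : 'M[cplx R]_n).
have mphi : measurable_fun setT phi.
  exact: (measurableT_comp (measurable_mulmxl V) (measurable_funP U)).
have h A (mA : measurable A) : P [set w | A (phi w)] = mu A.
  by case: muinv => _ muV; exact: (muV V A (expi_unitary _) mA).
have mL : measurable_fun setT (fun M : mxborel R n => (logdet M ^+ k)%:E).
  by apply/measurable_EFinP/measurable_funX; exact: measurable_logdet.
have E (w : T) : (relogZ (U w) theta ^+ k)%:E = (logdet (phi w) ^+ k)%:E.
  by rewrite relogZ_logdet.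
split.
  under eq_fun do rewrite E.
  exact/(integrable_image mphi h mL).
under eq_integral do rewrite E.
rewrite (integral_image mphi h mL (il k)) /logdet_moment /Rintegral fineK//.
exact: integrable_fin_num (il k).
Qed.

Lemma moment_seq_logdet : moment_seq n logdet_moment.
Proof. by have [_] := logdet_moment_seq (haar_left_invariant haarU). Qed.

Lemma sigma_relogZE : sigma_relogZ P U theta = Num.sqrt (logdet_moment 2).
Proof.
have [_ m1 _ _ _] := moment_seq_low moment_seq_logdet.
have E1 : 'E_P[fun w => relogZ (U w) theta]%E = 0%E.
  rewrite unlock -[RHS]/(0%R%:E) -m1 -(relogZ_moment 1).2.
  by apply: eq_integral => w _; rewrite expr1.
rewrite /sigma_relogZ /variance covariance.unlock E1 /=.
rewrite unlock.
rewrite (_ : (\int[P]_w _)%E = (logdet_moment 2)%:E)//.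
rewrite -(relogZ_moment 2).2; apply: eq_integral => w _.
rewrite expr2; congr (_ * _)%:E; exact: subr0.
Qed.

(** For even [k] only powers of [sigma^2] occur, and the square root disappears. *)
Lemma normalizedZ_moment (k : nat) : ~~ odd k ->
  'E_P[fun w => (normalizedZ P U theta w ^+ k)%R]%E =
  (logdet_moment k / logdet_moment 2 ^+ k./2)%:E.
Proof.
move=> ek; have [_ _ s0 _ _] := moment_seq_low moment_seq_logdet.
have sk : sigma_relogZ P U theta ^+ k = logdet_moment 2 ^+ k./2.
  have e : k = (2 * k./2)%N by rewrite mul2n even_halfK.
  by rewrite [in LHS]e exprM sigma_relogZE sqr_sqrtr.
rewrite unlock /normalizedZ.
under eq_integral do rewrite expr_div_n sk mulrC EFinM.
rewrite integralZl//; last exact: (relogZ_moment k).1.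
by rewrite (relogZ_moment k).2 -EFinM mulrC.
Qed.

End relogZ_moments.

Lemma standard_normal_moment (R : realType) (d : measure_display)
    (T : measurableType d) (Q : probability T R) (N : {RV Q >-> R}) (k : nat) :
  standard_normal N -> ~~ odd k ->
  'E_Q[fun w => (N w ^+ k)%R]%E = (gauss_moment R k)%:E.
Proof.
move=> NN ek; rewrite unlock -integral_normal_prob_pow//.
have mN : @measurable_fun _ _ T (measurableTypeR R) setT N.
  exact: (measurable_funP N).
have h (A : set (measurableTypeR R)) (mA : measurable A) :
    Q [set w | A (N w)] = normal_prob 0 1 A by exact: NN.
apply: (@ge0_integral_image R _ _ T (measurableTypeR R) Q (normal_prob 0 1) N mN h
  (fun x => (x ^+ k)%:E)).
- apply/measurable_EFinP; exact: (@exprn_measurable R setT k).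
- by move=> x; rewrite lee_fin exprn_even_ge0.
Qed.

Theorem mainTheorem10 (R : realType) (k : nat) :
  (4 <= k)%N -> ~~ odd k ->
  exists C1 : R,
  forall (n : nat) (theta : R)
    (d : measure_display) (T : measurableType d) (P : probability T R)
    (U : {RV P >-> mxborel R n})
    (d' : measure_display) (T' : measurableType d') (Q : probability T' R)
    (N : {RV Q >-> R}),
  (2 <= n)%N ->
  haar_unitary (distribution P U) ->
  standard_normal N ->
  (`| 'E_P[fun w => (normalizedZ P U theta w ^+ k)%R]
      - 'E_Q[fun w => (N w ^+ k)%R] |
     <= (C1 * (1 / ln n%:R))%:E)%E.
Proof.
move=> k4 ek; have [C hC] := normalized_moment_bound R k4 ek.
exists C => n theta d T P U d' T' Q N n2 haarU NN.
rewrite (normalizedZ_moment theta haarU ek) (standard_normal_moment NN ek).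
rewrite -EFinB abse_EFin lee_fin mul1r.
exact: hC n2 (moment_seq_logdet haarU).
Qed.
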